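(* Let $K$ be an algebraically closed field, $n\geq 2$, $\ell\geq 1$, and let $P,Q_1,\ldots,Q_\ell\in K[\underline{x}]$ (with $\underline{x}=(x_1,\ldots,x_n)$) be non-zero polynomials, pairwise distinct up to multiplicative constants, relatively prime, and not all constant. Suppose $F(\underline{x},\underline{\lambda})=P(\underline{x})+\lambda_1Q_1(\underline{x})+\cdots+\lambda_\ell Q_\ell(\underline{x})$ admits two maximal homogeneous decompositions $$F(\underline{x},\underline{\lambda})=H_1(\phi_1(\underline{x}),\psi_1(\underline{x}),\underline{\lambda})=H_2(\phi_2(\underline{x}),\psi_2(\underline{x}),\underline{\lambda}).$$ Then there exists $L\in\mathrm{GL}_2(K)$ such that $(\phi_1,\psi_1)=L(\phi_2,\psi_2)$. Furthermore, if the two decompositions are reduced, then $c\cdot H_2(u,v,\underline{\lambda})=H_1(u,v,\underline{\lambda})\circ L(u,v)$ for some constant $c\in K$.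
   Context: $\underline{\lambda}=(\lambda_1,\ldots,\lambda_\ell)$ is a tuple of independent indeterminates and $\overline{k}$ denotes an algebraic closure of a field $k$. ''Relatively prime'' for $P,Q_1,\ldots,Q_\ell$ means that no non-constant polynomial divides all of them. Given relatively prime $\phi,\psi\in K[\underline{x}]$ with $\deg_{\underline{x}}(F)>\max(\deg(\phi),\deg(\psi))$, a $(\phi,\psi)$-homogeneous decomposition of $F$ (of degree $d$) is an identity $F(\underline{x},\underline{\lambda})=H(\phi(\underline{x}),\psi(\underline{x}),\underline{\lambda})$ with $H(u,v,\underline{\lambda})\in\overline{K(\underline{\lambda})}[u,v]$ homogeneous (of degree $d$) in $(u,v)$. It is maximal if $\phi+\lambda\psi$ is irreducible in $\overline{K(\lambda)}[\underline{x}]$, where $\lambda$ is a new single indeterminate. It is reduced if $H$ has no linear factor $\alpha u+\beta v\in K[u,v]$ (with $(\alpha,\beta)\neq(0,0)$) such that $\alpha\phi+\beta\psi$ is constant in $\underline{x}$. *)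

(* Defs.v *)
From mathcomp Require Import all_boot all_order all_algebra.
From mathcomp Require Import mpoly.

Set Implicit Arguments.
Unset Strict Implicit.
Unset Printing Implicit Defensive.

Import GRing.Theory.
Local Open Scope ring_scope.

Section Divisibility.
Variables (n : nat) (R : idomainType).
Implicit Types (p q D : {mpoly R[n]}) (s : seq {mpoly R[n]}).

(* [msize p] is the total degree plus one, and 0 when [p = 0]. *)
Definition const_mpoly p : bool := (msize p <= 1)%N.

Definition mpoly_divides D p : Prop := exists q, p = q * D.

Definition relatively_prime s : Prop :=
  forall D, (forall p, p \in s -> mpoly_divides D p) -> const_mpoly D.

Definition equal_up_to_constant p q : Prop := exists2 c : R, c != 0 & p = c *: q.

Definition irreducible_mpoly p : Prop :=
  [/\ p != 0, p \isn't a GRing.unit &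
      forall q r, p = q * r -> q \is a GRing.unit \/ r \is a GRing.unit].

End Divisibility.

Definition is_algebraic_closure (k : fieldType) (k' : closedFieldType)
    (iota : {rmorphism k -> k'}) : Prop :=
  forall z : k', algebraicOver iota z.

(* K[lambda] is {mpoly K[l]} and K(lambda) is its fraction field; the map
   [iota] embeds K(lambda) into an algebraic closure [Om]. *)
Section Embeddings.
Variables (K : fieldType) (l : nat) (Om : closedFieldType).
Variable iota : {rmorphism {fraction {mpoly K[l]}} -> Om}.

Definition of_params : {mpoly K[l]} -> Om := iota \o @tofrac {mpoly K[l]}.
Definition of_base : K -> Om := of_params \o @mpolyC l K.

End Embeddings.

(* P + lambda_1 Q_1 + ... + lambda_l Q_l in K[lambda][x] *)
Definition linear_family (K : fieldType) (n l : nat)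
    (P : {mpoly K[n]}) (Q : 'I_l -> {mpoly K[n]}) : {mpoly {mpoly K[l]}[n]} :=
  map_mpoly (@mpolyC l K) P
  + \sum_(i < l) ('X_i : {mpoly K[l]}) *: map_mpoly (@mpolyC l K) (Q i).

Definition lin_act (R : nzRingType) (V : lmodType R) (m : nat)
    (L : 'M[R]_m) (w : m.-tuple V) : m.-tuple V :=
  [tuple \sum_(j < m) L i j *: tnth w j | i < m].

Section Decompositions.
Variables (K : closedFieldType) (n l : nat) (Om : closedFieldType).
Variable iota : {rmorphism {fraction {mpoly K[l]}} -> Om}.

Definition homogeneous_decomposition (F : {mpoly {mpoly K[l]}[n]})
    (phi psi : {mpoly K[n]}) (H : {mpoly Om[2]}) (d : nat) : Prop :=
  [/\ relatively_prime [:: phi; psi],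
      (maxn (msize phi) (msize psi) < msize F)%N,
      H \is d.-homog &
      map_mpoly (of_params iota) F =
        H \mPo [tuple map_mpoly (of_base iota) phi;
                      map_mpoly (of_base iota) psi]].

Definition reduced_decomposition (phi psi : {mpoly K[n]}) (H : {mpoly Om[2]}) : Prop :=
  forall alpha beta : K, (alpha, beta) != (0, 0) ->
    mpoly_divides (of_base iota alpha *: 'X_ord0 + of_base iota beta *: 'X_ord_max) H ->
    ~~ const_mpoly (alpha *: phi + beta *: psi).

End Decompositions.

(* Here [iota] embeds the field K(lambda) in a single indeterminate lambda
   into an algebraic closure. *)
Definition maximal_pencil (K : closedFieldType) (n : nat) (M : closedFieldType)
    (iota : {rmorphism {fraction {mpoly K[1]}} -> M})
    (phi psi : {mpoly K[n]}) : Prop :=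
  irreducible_mpoly
    (map_mpoly (of_params iota) (linear_family phi (fun _ : 'I_1 => psi))).

(* Main.v *)
From HB Require Import structures.
From Stdlib Require Import Classical.
Require Import Defs.
From mathcomp Require Import all_boot all_order all_algebra.
From mathcomp Require Import mpoly ring.

Set Implicit Arguments.
Unset Strict Implicit.
Unset Printing Implicit Defensive.

Import GRing.Theory.
Local Open Scope ring_scope.

(** Over the algebraic closure [Om] of [K(lambda)] the form [H] of a
    homogeneous decomposition splits into linear forms, so the family
    [F = P + lambda_1 Q_1 + ... + lambda_l Q_l] becomes a product of a constant,
    a power of [psi], and members [phi - r psi] of the pencil of the
    decomposition, with [r] in [Om].  Two facts control these factors.

    - If [r] lies in [K], then [phi - r psi] divides [F] over [Om]; the elements
      [1, lambda_1, ..., lambda_l] being linearly independent over [K], it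
      divides [P] and all the [Q_i] over [K], hence is constant
      ([linear_family_coprime]).  The same applies to [psi] if it occurs.
      In particular a reduced decomposition has no such factor.
    - If [r] lies outside [K], it is transcendental over [K], and
      [phi - r psi] is irreducible over [Om], since it is so for one
      transcendental parameter, by maximality.  Indeed the coefficients of a
      factorization over [Om] generate a finitely generated extension of
      [K[r]], and a morphism [K[X] -> M] that sends [X] to the negative of the
      generic parameter extends to the finitely many coefficients
      ([specialize_finite]), which yields a factorization over [M]
      ([pencil_irreducible]).

    As [Om[x_1, ..., x_n]] is factorial ([factorial_mpoly], by Gauss's theorem),
    irreducible polynomials are prime.  Since [F] is not constant, some factor
    [phi1 - r psi1] with [r] outside [K] occurs in the first decomposition; it
    is prime, so it is proportional to a factor [phi2 - t psi2] of the second.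
    As [1] and [r] are independent over [K], [phi1] and [psi1] are then
    [K]-combinations of [phi2] and [psi2] ([span_mlincomb]), which gives [L].
    If both decompositions are reduced, substituting [L] turns the first one
    into a second product of prime members of the pencil of [phi2] and [psi2];
    by unique factorization the two products have the same constant and the
    same parameters ([pencil_unique_factorization]), hence [H2] is [H1]
    composed with [L], and the constant [c] is [1]. *)

(** * Factorial domains *)

(** [p] divides [a] in [R]. *)
Definition divides (R : idomainType) (p a : R) : Prop := exists q, a = q * p.

(** Prime elements: nonzero nonunits that divide a product only if they divide
    one of the factors. *)
Definition prime_elt (R : idomainType) (p : R) : Prop :=
  [/\ p != 0, p \isn't a GRing.unit &
      forall a b, divides p (a * b) -> divides p a \/ divides p b].

(** [prime_product k a]: [a] is a unit times a product of [k] primes. *)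
Inductive prime_product (R : idomainType) : nat -> R -> Prop :=
| Prime_product_unit u : u \is a GRing.unit -> prime_product 0 u
| Prime_product_cons k p a :
    prime_elt p -> prime_product k a -> prime_product k.+1 (p * a).

(** A factorial domain: every nonzero element is a unit times a product of
    primes.  Uniqueness of the factorization is automatic for primes. *)
Definition factorial_domain (R : idomainType) : Prop :=
  forall a : R, a != 0 -> exists k, prime_product k a.

Lemma prime_product_neq0 (R : idomainType) k (a : R) :
  prime_product k a -> a != 0.
Proof.
elim=> [u uU|{}k p {}a [p0 _ _] _ a0]; last by rewrite mulf_neq0.
by apply: contraTneq uU => ->; rewrite unitr0.
Qed.

Lemma prime_product_unitl (R : idomainType) k (u a : R) :
  u \is a GRing.unit -> prime_product k a -> prime_product k (u * a).
Proof.
move=> uU; elim=> [v vU|{}k p {}a pP _ IH].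
  by apply: Prime_product_unit; rewrite unitrM uU.
by rewrite mulrCA; apply: Prime_product_cons.
Qed.

Lemma prime_product_mul (R : idomainType) k m (a b : R) :
  prime_product k a -> prime_product m b -> prime_product (k + m) (a * b).
Proof.
move=> + bP; elim=> [u uU|{}k p {}a pP _ IH]; first exact: prime_product_unitl.
by rewrite -mulrA addSn; apply: Prime_product_cons.
Qed.

Lemma prime_elt_irreducible (R : idomainType) (p a b : R) :
  prime_elt p -> p = a * b -> a \is a GRing.unit \/ b \is a GRing.unit.
Proof.
case=> p0 _ pP pE.
have [|[q aE]|[q bE]] := pP a b; first by exists 1; rewrite mul1r pE.
  right; suff qb1 : q * b = 1 by apply/unitrP; exists q; rewrite [b * q]mulrC.
  by apply: (mulIf p0); rewrite mul1r mulrAC -aE -pE.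
left; suff aq1 : a * q = 1 by apply/unitrP; exists q; rewrite [q * a]mulrC.
by apply: (mulIf p0); rewrite mul1r -mulrA -bE -pE.
Qed.

Lemma prime_dvd_prime (R : idomainType) (p q : R) :
  prime_elt p -> prime_elt q -> divides p q ->
  exists2 u, u \is a GRing.unit & q = u * p.
Proof.
move=> [_ pU _] qP [u qE]; exists u => //.
by case: (prime_elt_irreducible qP qE) => // pU'; rewrite pU' in pU.
Qed.

(** Dividing by a prime lowers the number of prime factors. *)
Lemma prime_product_cancel (R : idomainType) k (p b : R) :
  prime_elt p -> prime_product k (p * b) ->
  exists2 m, (m < k)%N & prime_product m b.
Proof.
move=> pP; have [p0 pU pD] := pP.
move E: (p * b) => c cP; elim: cP b E => [u uU|{}k q a qP aP IH] b E.
  by move: uU; rewrite -E unitrM (negPf pU).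
have [|pq|[a' aE]] := pD q a; first by exists b; rewrite -E mulrC.
  have [u uU qE] := prime_dvd_prime pP qP pq.
  exists k => //; suff -> : b = u * a by apply: prime_product_unitl.
  by apply: (mulfI p0); rewrite E qE mulrCA mulrA.
have [|m ltmk a'P] := IH a'; first by rewrite mulrC.
exists m.+1 => //; suff -> : b = q * a' by apply: Prime_product_cons.
by apply: (mulfI p0); rewrite E aE; ring.
Qed.

(** In a factorial domain irreducible elements are prime. *)
Lemma factorial_irreducible_prime (R : idomainType) (p : R) :
  factorial_domain R -> p != 0 -> p \isn't a GRing.unit ->
  (forall a b, p = a * b -> a \is a GRing.unit \/ b \is a GRing.unit) ->
  prime_elt p.
Proof.
move=> ufdR p0 pU pirr; have [k pk] := ufdR p p0.
case: pk p0 pU pirr => [u uU|{}k q a qP _] p0 pU pirr; first by rewrite uU in pU.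
have [q0 qU qD] := qP.
have [qU'|aU] := pirr q a erefl; first by rewrite qU' in qU.
split=> // b c [d bcE].
have dvd_qa x : divides q x -> divides (q * a) x.
  by case=> y ->; exists (y / a); rewrite mulrCA divrK // mulrC.
by have [||] := qD b c; [exists (d * a); rewrite bcE; ring | left | right]; auto.
Qed.

(** * Gauss's theorem: polynomials over a factorial domain *)

(** Divisibility by a constant is tested on the coefficients. *)
Lemma dividesCP (R : idomainType) (c : R) (f : {poly R}) :
  divides c%:P f <-> forall i, divides c f`_i.
Proof.
split=> [[q ->] i|cf]; first by exists q`_i; rewrite coefMC.
have [g gE] : exists g : nat -> R, forall i, (i < size f)%N -> f`_i = g i * c.
  elim: (size f) => [|k [g gE]]; first by exists (fun=> 0).
  have [a aE] := cf k; exists (fun i => if i == k then a else g i) => i.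
  by rewrite ltnS leq_eqVlt; case: eqP => [->|_] //= /gE.
exists (\poly_(i < size f) g i); apply/polyP => i; rewrite coefMC coef_poly.
by case: ltnP => [/gE //|]; rewrite mul0r => /(nth_default 0).
Qed.

Lemma prime_polyC (R : idomainType) (p : R) : prime_elt p -> prime_elt p%:P.
Proof.
move=> [p0 pU pP]; split; first by rewrite polyC_eq0.
  by rewrite poly_unitE size_polyC p0 coefC.
move=> f g /dividesCP pfg; apply: NNPP => /not_or_and [].
(* The lowest coefficients of f and g not divisible by p produce one of
   f * g that p does not divide. *)
have low (h : {poly R}) : ~ divides p%:P h ->
    exists i, ~ divides p h`_i /\ forall j, (j < i)%N -> divides p h`_j.
  move=> nph; have [i] : exists i, ~ divides p h`_i.
    by apply: NNPP => nex; apply/nph/dividesCP => i; apply: NNPP => ?; apply: nex; exists i.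
  elim/ltn_ind: i => i IH npi.
  have [[j [ltji npj]]|nex] := classic (exists j, (j < i)%N /\ ~ divides p h`_j).
    exact: IH ltji npj.
  by exists i; split=> // j ltji; apply: NNPP => npj; apply: nex; exists j.
move=> /low [i [npi lowi]] /low [j [npj lowj]].
have := pfg (i + j)%N; rewrite coefM.
have lti : (i < (i + j).+1)%N by rewrite ltnS leq_addr.
rewrite (bigD1 (Ordinal lti)) //= addKn.
have [s ->] : divides p (\sum_(k < (i + j).+1 | k != Ordinal lti) f`_k * g`_(i + j - k)).
  apply: big_ind => [|_ _ [a ->] [b ->]|k]; first by exists 0; rewrite mul0r.
    by exists (a + b); rewrite mulrDl.
  rewrite -val_eqE /= neq_ltn => /orP[/lowi[a ->]|ltik].
    by exists (a * g`_(i + j - k)); rewrite mulrAC.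
  have [|b ->] := lowj (i + j - k)%N; last by exists (f`_k * b); rewrite mulrA.
  by rewrite ltn_subLR ?ltn_add2r // -ltnS ltn_ord.
case=> q qE; have : divides p (f`_i * g`_j).
  by exists (q - s); rewrite mulrBl -qE addrK.
by case/pP.
Qed.

Lemma prime_product_polyC (R : idomainType) k (a : R) :
  prime_product k a -> prime_product k a%:P.
Proof.
elim=> [u uU|{}k p {}a pP _ IH]; first exact/Prime_product_unit/rmorph_unit.
by rewrite polyCM; apply: Prime_product_cons => //; apply: prime_polyC.
Qed.

(** A polynomial is primitive when no prime constant divides it. *)
Definition primitive (R : idomainType) (f : {poly R}) : Prop :=
  forall p : R, prime_elt p -> ~ divides p%:P f.

(** The content is split off prime by prime; the number of prime factors of the
    leading coefficient decreases at each step. *)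
Lemma primitive_part (R : idomainType) (f : {poly R}) :
  factorial_domain R -> f != 0 ->
  exists c g, [/\ c != 0, f = c *: g & primitive g].
Proof.
move=> ufdR f0; have [|k] := ufdR (lead_coef f); first by rewrite lead_coef_eq0.
elim/ltn_ind: k f f0 => k IH f f0 fk.
have [prim|] := classic (primitive f).
  by exists 1, f; rewrite oner_neq0 scale1r.
move=> /not_all_ex_not[p] /(@imply_to_and _ (~ divides _ _))[pP] /NNPP[g fE].
have [p0 _ _] := pP; have fE' : f = p *: g by rewrite fE mulrC mul_polyC.
have g0 : g != 0 by apply: contraNneq f0 => g0; rewrite fE g0 mul0r.
have [|m ltmk mP] := @prime_product_cancel _ k p (lead_coef g) pP.
  by rewrite -lead_coefZ -fE'.
have [c [h [c0 gE hP]]] := IH m ltmk g g0 mP.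
by exists (p * c), h; rewrite mulf_neq0 // fE' gE scalerA.
Qed.

Lemma scale_polyI (R : idomainType) (c : R) :
  c != 0 -> injective ( *:%R c : {poly R} -> {poly R}).
Proof.
by move=> c0 f g; rewrite -!mul_polyC; apply: mulfI; rewrite polyC_eq0.
Qed.

(** Denominators can be cleared from a factorization. *)
Lemma clear_denominators (R : idomainType) k (a : R) (f q r : {poly R}) :
  prime_product k a -> a *: f = q * r ->
  exists q' r', [/\ f = q' * r', size q' = size q & size r' = size r].
Proof.
move=> aP; elim: aP q r => [u uU|{}k p {}a pP _ IH] q r E.
  exists (u^-1 *: q), r; split=> //.
    by rewrite -scalerAl -E scalerA mulVr // scale1r.
  by rewrite size_scale // invr_eq0 (prime_product_neq0 (Prime_product_unit uU)).
have [p0 _ _] := pP; have pP' := prime_polyC pP.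
have pE (h : {poly R}) : h * p%:P = p *: h by rewrite mulrC mul_polyC.
have pI := scale_polyI p0.
have [_ _ pD] := pP'.
have [|[h hE]|[h hE]] := pD q r; first by exists (a *: f); rewrite -E pE scalerA.
  have [|q' [r' [fE sq' sr']]] := IH h r.
    by apply: pI; rewrite scalerA E hE pE scalerAl.
  by exists q', r'; rewrite hE pE size_scale.
have [|q' [r' [fE sq' sr']]] := IH q h.
  by apply: pI; rewrite scalerA E hE pE scalerAr.
by exists q', r'; rewrite hE pE size_scale.
Qed.

(** Gauss's lemma: divisibility by a primitive polynomial over the fraction
    field is divisibility over the domain. *)
Lemma primitive_divides (R : idomainType) k (a : R) (f g q : {poly R}) :
  primitive f -> prime_product k a -> a *: g = q * f -> divides f g.
Proof.
move=> fprim aP; elim: aP q => [u uU|{}k p {}a pP _ IH] q E.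
  by exists (u^-1 *: q); rewrite -scalerAl -E scalerA mulVr // scale1r.
have [p0 _ _] := pP; have [_ _ pD] := prime_polyC pP.
have pE (h : {poly R}) : h * p%:P = p *: h by rewrite mulrC mul_polyC.
have [|[h hE]|/(fprim _ pP)] := pD q f; last by [].
  by exists (a *: g); rewrite -E pE scalerA.
apply: (IH h); by apply: (scale_polyI p0); rewrite scalerA E hE pE scalerAl.
Qed.

(** A primitive polynomial that is irreducible over the fraction field is
    prime. *)
Lemma primitive_irreducible_prime (R : idomainType) (f : {poly R}) :
  factorial_domain R -> primitive f -> irreducible_poly f -> prime_elt f.
Proof.
move=> ufdR fprim [sf firr].
have f0 : f != 0 by rewrite -size_poly_gt0 ltnW.
have dvd_f g : (f %| g)%R -> divides f g.
  case/Pdiv.Idomain.dvdpP => [[c q] /= c0 E].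
  by have [k ck] := ufdR c c0; apply: primitive_divides fprim ck E.
split=> //; first by rewrite poly_unitE; case: eqP sf => [->|].
move=> g h [q qE].
have [|nfg] := boolP (f %| g)%R; first by left; apply: dvd_f.
right; apply: dvd_f; rewrite -(@Pdiv.Idomain.Gauss_dvdpr _ h g f).
  by rewrite qE Pdiv.Idomain.dvdp_mulIr.
rewrite Pdiv.Idomain.coprimep_def; apply: contraNT nfg => sg.
have := firr _ sg (Pdiv.Idomain.dvdp_gcdl _ _).
by move=> /Pdiv.Idomain.eqp_dvdl <-; apply: Pdiv.Idomain.dvdp_gcdr.
Qed.

(** Induction on the degree: a primitive polynomial that is reducible over the
    fraction field is, after clearing denominators, a product of two
    polynomials of smaller degree. *)
Theorem factorial_poly (R : idomainType) :
  factorial_domain R -> factorial_domain {poly R}.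
Proof.
move=> ufdR f f0; have [N leN] := ubnP (size f); elim: N f f0 leN => // N IH f f0.
rewrite ltnS => leN; have [sf1|sf1] := leqP (size f) 1.
  move/size1_polyC: sf1 f0 => ->; rewrite polyC_eq0 => c0.
  by have [k kP] := ufdR _ c0; exists k; apply: prime_product_polyC.
have [c [g [c0 fE gprim]]] := primitive_part ufdR f0.
have sg : size g = size f by rewrite fE size_scale.
have [k /prime_product_polyC ck] := ufdR c c0.
suff [m gm] : exists m, prime_product m g.
  by exists (k + m)%N; rewrite fE -mul_polyC; apply: prime_product_mul.
have g0 : g != 0 by rewrite -size_poly_gt0 sg ltnW.
have [girr|] := classic (irreducible_poly g).
  exists 1%N; rewrite -[g]mulr1; apply: Prime_product_cons.
    exact: primitive_irreducible_prime.
  exact/Prime_product_unit/unitr1.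
move=> nirr; have [q [sq1 qg nqg]] : exists q : {poly R},
    [/\ size q != 1%N, (q %| g)%R & ~~ (q %= g)%R].
  apply: NNPP => nex; apply: nirr; split=> [|q sq1 qg]; first by rewrite sg.
  by apply: contraT => nqg; case: nex; exists q.
have /Pdiv.Idomain.dvdpP [[a r] /= a0 E] := qg.
have q0 := Pdiv.Idomain.dvdpN0 qg g0.
have r0 : r != 0.
  apply/eqP => r0; move/eqP: E.
  by rewrite r0 mul0r -mul_polyC mulf_eq0 polyC_eq0 (negPf a0) (negPf g0).
have sr1 : size r != 1%N.
  apply: contra nqg => /size_poly1P[b b0 rE]; apply/Pdiv.Idomain.eqpP.
  by exists (b, a); rewrite //= ?b0 // E rE mul_polyC.
have [m am] := ufdR a a0.
have [r' [q' [gE sr' sq']]] := clear_denominators am E.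
have r'0 : r' != 0 by rewrite -size_poly_gt0 sr' size_poly_gt0.
have q'0 : q' != 0 by rewrite -size_poly_gt0 sq' size_poly_gt0.
have lt1 (h : {poly R}) : h != 0 -> size h != 1%N -> (1 < size h)%N.
  by rewrite -size_poly_gt0; case: (size h) => [|[]].
have sE : (size f).+1 = (size r + size q)%N.
  rewrite -sg gE size_mul // prednK ?sr' ?sq' //.
  by rewrite addn_gt0 size_poly_gt0 r0.
have := lt1 _ r0 sr1; have := lt1 _ q0 sq1 => sq sr.
have [k1 r'k] : exists k, prime_product k r'.
  apply: IH; rewrite // sr'; apply: leq_trans leN.
  by rewrite -ltnS sE -[(size r).+1]addn1 ltn_add2l.
have [k2 q'k] : exists k, prime_product k q'.
  apply: IH; rewrite // sq'; apply: leq_trans leN.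
  by rewrite -ltnS sE -[(size q).+1]add1n ltn_add2r.
by exists (k1 + k2)%N; rewrite gE; apply: prime_product_mul.
Qed.

(** * Multivariate polynomials over a field *)

(** Factoriality is invariant under ring isomorphisms. *)
Lemma factorial_transfer (R S : idomainType) (f : {rmorphism R -> S}) (g : S -> R) :
  cancel f g -> cancel g f -> factorial_domain S -> factorial_domain R.
Proof.
move=> fK gK ufdS a a0.
have gM x y : g (x * y) = g x * g y.
  by apply: (can_inj fK); rewrite rmorphM !gK.
have g1 : g 1 = 1 by apply: (can_inj fK); rewrite rmorph1 gK.
have g0 x : (g x == 0) = (x == 0).
  by rewrite -(inj_eq (can_inj fK)) rmorph0 gK.
have gU x : (g x \is a GRing.unit) = (x \is a GRing.unit).
  apply/idP/idP => [/(rmorph_unit f)|/unitrP[y [yx xy]]]; first by rewrite gK.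
  by apply/unitrP; exists (g y); rewrite -!gM yx xy g1.
have gP x : prime_elt x -> prime_elt (g x).
  move=> [x0 xU xD]; split; rewrite ?g0 ?gU // => b c [q qE].
  have [|[d dE]|[d dE]] := xD (f b) (f c).
  - by exists (f q); rewrite -rmorphM qE rmorphM gK.
  - by left; exists (g d); rewrite -gM -dE fK.
  - by right; exists (g d); rewrite -gM -dE fK.
have [|k] := ufdS (f a); first by apply: contraNneq a0 => fa0; rewrite -[a]fK fa0 g0.
move=> fak; exists k; rewrite -[a]fK.
elim: fak => [u uU|{}k p b pP _ IH]; first by apply: Prime_product_unit; rewrite gU.
by rewrite gM; apply: Prime_product_cons => //; apply: gP.
Qed.

(** A ring morphism on polynomials is determined by its values on the constants
    and the variables. *)
Lemma eq_mpoly_rmorphism (R : comNzRingType) (S : nzRingType) n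
    (f g : {rmorphism {mpoly R[n]} -> S}) :
  (forall c, f c%:MP = g c%:MP) -> (forall i, f 'X_i = g 'X_i) -> f =1 g.
Proof.
move=> fgC fgX p; rewrite [p]mpolyE !rmorph_sum; apply: eq_bigr => m _.
rewrite -mul_mpolyC !rmorphM fgC mpolyXE_id !rmorph_prod; congr (_ * _).
by apply: eq_bigr => i _; rewrite !rmorphXn fgX.
Qed.

Lemma muni_XU n (R : comNzRingType) (i : 'I_n) :
  muni ('X_(widen_ord (leqnSn n) i) : {mpoly R[n.+1]}) = ('X_i)%:P.
Proof.
rewrite muniE msuppX big_seq1 mcoeffX eqxx scale1r mnm1E.
rewrite -val_eqE /= ltn_eqF // expr0 alg_polyC; congr ('X_[_])%:P.
by apply/mnmP => j; rewrite !mnmE -!val_eqE.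
Qed.

Lemma muni_Xmax n (R : comNzRingType) :
  muni ('X_ord_max : {mpoly R[n.+1]}) = 'X.
Proof.
rewrite muniE msuppX big_seq1 mcoeffX eqxx scale1r mnm1E eqxx expr1.
rewrite (_ : [multinom _ | i < n] = 0%MM) ?mpolyX0 ?scale1r //.
by apply/mnmP => j; rewrite !mnmE -val_eqE /= gtn_eqF.
Qed.

(** Induction on the number of variables: the isomorphism between
    [{mpoly k[n.+1]}] and [{poly {mpoly k[n]}}] reduces to Gauss's theorem. *)
Theorem factorial_mpoly (k : fieldType) n : factorial_domain {mpoly k[n]}.
Proof.
elim: n => [|n IH].
  move=> p p0; exists 0%N; apply: Prime_product_unit; apply/andP.
  have pE : p = (p@_0)%:MP.
    by apply/mpolyP => m; rewrite mcoeffC (_ : m = 0%MM) ?eqxx ?mulr1 //; apply/mnmP => -[].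
  by split; [apply/eqP | rewrite unitfE; apply: contraNneq p0 => c0; rewrite pE c0 mpolyC0].
pose g : {poly {mpoly k[n]}} -> {mpoly k[n.+1]} :=
  horner_eval 'X_ord_max \o map_poly (@mwiden n k).
apply: (@factorial_transfer _ _ (@muni n k) g _ _ (factorial_poly IH)).
  move=> p; pose h := g \o @muni n k.
  have gE : h =1 idfun.
    apply: (@eq_mpoly_rmorphism _ _ _ h idfun) => [c|i].
      by rewrite /h /g /= muniC map_polyC /horner_eval hornerC /= mwidenC.
    rewrite /h /g /=.
    have [ltin|] := ltnP i n.
      have -> : i = widen_ord (leqnSn n) (Ordinal ltin) by apply: val_inj.
      rewrite muni_XU map_polyC /horner_eval hornerC /= mwidenX.
      by rewrite mnmwiden1; congr 'X_[_]; congr (U_(_))%MM; apply: val_inj.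
    move=> leni; have -> : i = ord_max.
      by apply: val_inj; apply/eqP; rewrite eqn_leq leni -ltnS ltn_ord.
    by rewrite muni_Xmax map_polyX /horner_eval hornerX.
  exact: gE.
move=> q; rewrite /g /= /horner_eval.
elim/poly_ind: q => [|q c IHq]; first by rewrite !raddf0 horner0 raddf0.
rewrite rmorphD rmorphM /= map_polyX map_polyC hornerMXaddC rmorphD rmorphM /=.
rewrite muni_Xmax IHq; congr (_ + _).
pose h : {mpoly k[n]} -> {poly {mpoly k[n]}} := @muni n k \o @mwiden n k.
have : h =1 polyC.
  apply: (@eq_mpoly_rmorphism _ _ _ h polyC) => [a|i]; first by rewrite /h /= mwidenC muniC.
  rewrite /h /= mwidenX mnmwiden1 -muni_XU.
  by congr (muni 'X_[_]); congr (U_(_))%MM; apply: val_inj.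
exact.
Qed.

Lemma irreducible_mpoly_prime (k : fieldType) n (p : {mpoly k[n]}) :
  irreducible_mpoly p -> prime_elt p.
Proof. by case=> p0 pU pirr; apply: factorial_irreducible_prime (@factorial_mpoly k n) _ _ _. Qed.

(** * Extension of specializations *)

Lemma ex_minimal (T : Type) (size : T -> nat) (A : T -> Prop) :
  (exists x, A x) ->
  exists2 x, A x & forall y, A y -> (size x <= size y)%N.
Proof.
case=> x; have [k] := ubnP (size x); elim: k x => // k IH x lek Ax.
have [[y [Ay lty]]|nex] := classic (exists y, A y /\ (size y < size x)%N).
  by apply: (IH y) => //; apply: leq_trans lty _; rewrite -ltnS.
by exists x => // y Ay; rewrite leqNgt; apply/negP => lty; apply: nex; exists y.
Qed.

(** The terms of [p] above the degree of its image under [i] can be dropped. *)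
Lemma map_poly_trim (R S : nzRingType) (i : {rmorphism R -> S}) (p : {poly R}) :
  exists2 q, map_poly i q = map_poly i p & size q = size (map_poly i p).
Proof.
pose q := \poly_(k < size (map_poly i p)) p`_k.
have qE : map_poly i q = map_poly i p.
  apply/polyP => k; rewrite !coef_map coef_poly; case: ltnP => // lek.
  by rewrite raddf0 -coef_map nth_default.
exists q => //; apply/eqP; rewrite eqn_leq size_poly.
by rewrite -qE size_poly.
Qed.

(** A relation over [B] satisfied by [c], of least degree among those whose
    image under [i] is nonzero. *)
Definition minimal_relation (B : idomainType) (E : fieldType)
    (i : {rmorphism B -> E}) (c : E) (m : {poly B}) : Prop :=
  [/\ (map_poly i m).[c] = 0, i (lead_coef m) != 0 &
      forall p : {poly B}, (map_poly i p).[c] = 0 -> (size p < size m)%N ->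
        map_poly i p = 0].

Lemma ex_minimal_relation (B : idomainType) (E : fieldType)
    (i : {rmorphism B -> E}) (c : E) (p : {poly B}) :
  (map_poly i p).[c] = 0 -> map_poly i p != 0 ->
  exists m, minimal_relation i c m.
Proof.
move=> pc p0.
pose A q := (map_poly i q).[c] = 0 /\ map_poly i q != 0.
have [q [qc q0] qmin] := @ex_minimal _ (fun q => size (map_poly i q)) A (ex_intro _ p (conj pc p0)).
have [m mE sm] := map_poly_trim i q; exists m; split; first by rewrite mE.
  by rewrite lead_coefE -coef_map mE sm -lead_coefE lead_coef_eq0.
move=> r rc ltr; apply/eqP/contraT => r0.
have := qmin r (conj rc r0); rewrite -sm leqNgt => /negP[].
by apply: leq_ltn_trans ltr; apply: size_poly.
Qed.

(** Every relation satisfied by [c] has zero image modulo a minimal one: its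
    pseudo-remainder is a relation of smaller degree. *)
Lemma minimal_relation_reduce (B : idomainType) (E : fieldType)
    (i : {rmorphism B -> E}) (c : E) (m p : {poly B}) :
  minimal_relation i c m -> (map_poly i p).[c] = 0 ->
  map_poly i (p %% m)%R = 0.
Proof.
case=> mc lm mmin pc.
have m0 : m != 0 by apply: contraNneq lm => ->; rewrite lead_coef0 raddf0.
apply: mmin; last by rewrite Pdiv.Idomain.ltn_modp.
have /(congr1 (fun q => (map_poly i q).[c])) := Pdiv.Idomain.divp_eq p m.
by rewrite map_polyZ rmorphD rmorphM /= hornerD hornerM hornerZ mc pc !mulr0 add0r.
Qed.

(** An element [g] of [B[X]] that does not vanish at [c] has a multiple whose
    value at [c] is the value of a constant: the minimal relation generates a
    maximal ideal over the fraction field of the image of [B]. *)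
Lemma minimal_relation_invert (B : idomainType) (E : fieldType)
    (i : {rmorphism B -> E}) (c : E) (m g : {poly B}) :
  minimal_relation i c m -> (map_poly i g).[c] != 0 ->
  exists (u : {poly B}) (w : B), i w != 0 /\ (map_poly i (u * g)).[c] = i w.
Proof.
move=> mP gc; have [mc lm mmin] := mP.
have m0 : m != 0 by apply: contraNneq lm => ->; rewrite lead_coef0 raddf0.
(* Among the polynomials with the same nonzero value at [c] as a multiple of
   [g], one of least degree is constant: a nonconstant one would have degree
   less than [m], and dividing [m] by it would produce a smaller relation or
   a smaller such polynomial. *)
pose A (h : {poly B}) := (map_poly i h).[c] != 0 /\
  exists u, (map_poly i (u * g)).[c] = (map_poly i h).[c].
have [|h [hc [u uE]] hmin] := @ex_minimal _ (fun h : {poly B} => size h) A.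
  by exists g; split=> //; exists 1; rewrite mul1r.
have [h' h'E sh'] := map_poly_trim i h.
have ltmin (r : {poly B}) : (size r < size h)%N -> ~ A r.
  by move=> ltr /hmin; rewrite leqNgt ltr.
have [sh|sh] := leqP (size h) 1.
  exists u, h`_0; rewrite uE (size1_polyC sh) coefC /= map_polyC hornerC.
  by split=> //; move: hc; rewrite {1}(size1_polyC sh) map_polyC hornerC.
have h0 : h != 0 by rewrite -size_poly_gt0 ltnW.
have lh : i (lead_coef h) != 0.
  have sE : size h = size (map_poly i h).
    apply/eqP; rewrite eqn_leq -{1}sh' hmin ?size_poly //.
    by split; rewrite h'E //; exists u.
  rewrite lead_coefE -coef_map sE -lead_coefE lead_coef_eq0.
  by apply: contraNneq hc => ->; rewrite horner0.
have ltm : (size h < size m)%N.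
  rewrite ltnNge; apply/negP => lem.
  apply: (ltmin (h %% m)%R).
    by apply: leq_trans lem; rewrite Pdiv.Idomain.ltn_modp.
  have /(congr1 (fun q => (map_poly i q).[c])) := Pdiv.Idomain.divp_eq h m.
  rewrite map_polyZ rmorphD rmorphM /= hornerD hornerM hornerZ mc mulr0 add0r => E1.
  split; first by rewrite -E1 mulf_neq0 // rmorphXn expf_neq0.
  exists (lead_coef m ^+ scalp h m *: u).
  by rewrite -E1 -scalerAl map_polyZ hornerZ uE.
have E1 := Pdiv.Idomain.divp_eq m h.
have /(congr1 (fun q => (map_poly i q).[c])) := E1.
rewrite map_polyZ rmorphD rmorphM /= hornerD hornerM hornerZ mc mulr0 => E2.
have qc : (map_poly i (m %/ h)%R).[c] = 0.
  have [rc|rc] := eqVneq (map_poly i (m %% h)%R).[c] 0.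
    by move/esym/eqP: E2; rewrite rc addr0 mulf_eq0 (negPf hc) orbF => /eqP.
  case: (ltmin (m %% h)%R); first by rewrite Pdiv.Idomain.ltn_modp.
  split=> //; exists (- (m %/ h)%R * u).
  rewrite -mulrA rmorphM hornerM uE rmorphN hornerN mulNr.
  by apply/eqP; rewrite eq_sym -addr_eq0 addrC -E2.
have q0 : map_poly i (m %/ h)%R = 0.
  apply: mmin => //; rewrite Pdiv.Idomain.size_divp //.
  by rewrite ltn_subrL -subn1 subn_gt0 sh (ltn_trans _ ltm) ?(ltn_trans _ sh).
have /(congr1 (fun q => (map_poly i q)`_(size m).-1)) := E1.
rewrite map_polyZ rmorphD rmorphM /= q0 mul0r add0r coefZ !coef_map -lead_coefE.
rewrite [X in _ = i X]nth_default => [|].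
  by move/eqP; rewrite raddf0 mulf_eq0 rmorphXn (negPf lm) orbF expf_eq0 (negPf lh) andbF.
rewrite -ltnS prednK ?size_poly_gt0 //.
by apply: leq_ltn_trans ltm; rewrite ltnW // Pdiv.Idomain.ltn_modp.
Qed.

Lemma closed_nonroot (M : closedFieldType) (p : {poly M}) :
  p != 0 -> exists x, p.[x] != 0.
Proof.
move=> p0; have [/eqP/size_poly1P[c c0 ->]|sp] := eqVneq (size p) 1%N.
  by exists 0; rewrite hornerC.
have [|x /rootP px] := closed_rootP (p - 1) _; last first.
  exists x; move/eqP: px; rewrite hornerD hornerN hornerC subr_eq0 => /eqP ->.
  exact: oner_neq0.
have sp1 : (1 < size p)%N by move: sp p0; rewrite -size_poly_gt0; case: (size p) => [|[]].
by rewrite size_polyDl // size_polyN size_poly1.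
Qed.

(** Specializing one element [c]: a morphism [j] defined on [B] that respects
    the relations of the image of [B] and does not kill a suitable [b] extends
    to [c], and can be made to avoid the zeros of a given [g]. *)
Lemma specialize_one (B : idomainType) (E : fieldType)
    (i : {rmorphism B -> E}) (c : E) (g : {poly B}) :
  (map_poly i g).[c] != 0 ->
  exists2 b, i b != 0 &
    forall (M : closedFieldType) (j : {rmorphism B -> M}),
      (forall x, i x = 0 -> j x = 0) -> j b != 0 ->
      exists c', (forall p : {poly B}, (map_poly i p).[c] = 0 -> (map_poly j p).[c'] = 0) /\
        (map_poly j g).[c'] != 0.
Proof.
move=> gc.
have kerP (M : closedFieldType) (j : {rmorphism B -> M}) : (forall x, i x = 0 -> j x = 0) ->
    forall p, map_poly i p = 0 -> map_poly j p = 0.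
  move=> ker p p0; apply/polyP => k; rewrite coef_map coef0; apply: ker.
  by rewrite -coef_map p0 coef0.
(* If [c] satisfies a relation, [c'] is a root of the image of a minimal one;
   otherwise any [c'] that is not a root of the image of [g] will do. *)
have [[p [pc p0]]|alg] := classic (exists p, (map_poly i p).[c] = 0 /\ map_poly i p != 0).
  have [m mP] := ex_minimal_relation pc p0; have [mc lm mmin] := mP.
  have [u [w [w0 uE]]] := minimal_relation_invert mP gc.
  exists (lead_coef m * w); first by rewrite rmorphM mulf_neq0.
  move=> M j ker; rewrite rmorphM mulf_eq0 => /norP[jm jw].
  have [|c' /rootP mc'] := closed_rootP (map_poly j m) _.
    rewrite size_map_poly_id0 //; apply: contraNneq lm => /eqP/size_poly1P[a a0 mE].
    by move: mc; rewrite mE lead_coefC map_polyC hornerC => ->.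
  have vanish q : (map_poly i q).[c] = 0 -> (map_poly j q).[c'] = 0.
    move=> qc; have /(congr1 (fun q => (map_poly j q).[c'])) := Pdiv.Idomain.divp_eq q m.
    rewrite map_polyZ rmorphD rmorphM /= (kerP _ _ ker _ (minimal_relation_reduce mP qc)).
    rewrite addr0 hornerM hornerZ mc' mulr0 => /eqP.
    by rewrite mulf_eq0 rmorphXn expf_eq0 (negPf jm) andbF => /eqP.
  exists c'; split=> //.
  have /eqP : (map_poly j (u * g - w%:P)).[c'] = 0.
    by apply: vanish; rewrite rmorphB /= hornerD hornerN uE map_polyC hornerC subrr.
  rewrite rmorphB rmorphM /= map_polyC hornerD hornerN hornerM hornerC subr_eq0.
  by apply: contraTneq => ->; rewrite mulr0 eq_sym.
have [k ck] : exists k, i g`_k != 0.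
  apply: NNPP => nex; case/eqP: gc; suff -> : map_poly i g = 0 by rewrite horner0.
  apply/polyP => k; rewrite coef_map coef0; apply/eqP/contraT => ck.
  by case: nex; exists k.
exists g`_k => // M j ker jk.
have [|c' gc'] := @closed_nonroot M (map_poly j g).
  by apply: contraNneq jk => g0; rewrite -coef_map g0 coef0.
exists c'; split=> // p pc; rewrite (kerP _ _ ker) ?horner0 //.
by apply/eqP/contraT => p0; case: alg; exists p.
Qed.

(** Every finite subset of an extension [E] of [A] lies in the image of a
    polynomial ring [C] over [A] with the following property: given a nonzero
    value [I g], a morphism from [A] to an algebraically closed field that
    respects the relations of [A] in [E] and avoids the zeros of a suitable
    nonzero [a] extends to a morphism [J] on [C] that respects the relations
    of [C] in [E] and does not kill [g]. *)
Theorem specialize_finite (A : idomainType) (E : fieldType)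
    (i : {rmorphism A -> E}) (s : seq E) :
  exists (C : idomainType) (e : {rmorphism A -> C}) (I : {rmorphism C -> E}),
    [/\ forall a, I (e a) = i a, forall x, x \in s -> exists y, I y = x &
      forall g, I g != 0 -> exists2 a, i a != 0 &
        forall (M : closedFieldType) (j : {rmorphism A -> M}),
          (forall x, i x = 0 -> j x = 0) -> j a != 0 ->
          exists J : {rmorphism C -> M},
            [/\ forall a, J (e a) = j a, forall x, I x = 0 -> J x = 0 & J g != 0]].
Proof.
elim: s => [|c s [C [e [I [Ie Is IJ]]]]].
  exists A, idfun, i; split=> // g ig; exists g => // M j ker jg.
  by exists j.
exists {poly C}, (@polyC C \o e : {rmorphism A -> {poly C}}).
exists (horner_eval c \o map_poly I : {rmorphism {poly C} -> E}).
split=> [a|x|g gc].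
- by rewrite /= map_polyC /horner_eval hornerC -Ie.
- rewrite inE => /orP[/eqP->|/Is[y yE]].
    by exists 'X; rewrite /= map_polyX /horner_eval hornerX.
  by exists y%:P; rewrite /= map_polyC /horner_eval hornerC.
have [b Ib bP] := specialize_one gc.
have [a ia aP] := IJ b Ib.
exists a => // M j ker ja.
have [J [Je JI Jb]] := aP M j ker ja.
have [c' [c'0 gc']] := bP M J JI Jb.
exists (horner_eval c' \o map_poly J : {rmorphism {poly C} -> M}).
split=> //= a'; by rewrite map_polyC /horner_eval hornerC -Je.
Qed.

(** * Descent along a field extension *)

Section LinearDescent.

Variables (K E : fieldType) (b : {rmorphism K -> E}).
Implicit Types (s t e : seq E) (k : nat -> K).

(** The combination of the entries of [s] with coefficients [k i] in [K]; the
    values of [k] beyond the size of [s] are irrelevant. *)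
Definition lincomb s k : E := \sum_(0 <= i < size s) b (k i) * s`_i.

(** [x] lies in the [K]-linear span of the entries of [s]. *)
Definition in_span s x : Prop := exists k, x = lincomb s k.

(** Linear independence over [K] of the entries of a sequence, repetitions
    counting as dependences. *)
Definition lin_indep s : Prop :=
  forall k, lincomb s k = 0 -> forall i, (i < size s)%N -> k i = 0.

Lemma lincomb_rcons s x k :
  lincomb (rcons s x) k = lincomb s k + b (k (size s)) * x.
Proof.
rewrite /lincomb size_rcons big_nat_recr //= nth_rcons ltnn eqxx; congr (_ + _).
by apply: eq_big_nat => i /= lti; rewrite nth_rcons lti.
Qed.

Lemma sum_cat_trunc (V : nmodType) s t (f : nat -> V) :
  \sum_(0 <= i < size (s ++ t)) (if (i < size s)%N then f i else 0) =
  \sum_(0 <= i < size s) f i.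
Proof.
rewrite size_cat (big_cat_nat (leq0n _) (leq_addr (size t) (size s))) /=.
rewrite [X in _ + X]big1_seq ?addr0 => [|i].
  by apply: eq_big_nat => i /= ->.
by rewrite mem_index_iota => /andP[_ /andP[les _]]; rewrite ltnNge les.
Qed.

Lemma in_span_cat s t x : in_span s x -> in_span (s ++ t) x.
Proof.
case=> k ->; exists (fun i => if (i < size s)%N then k i else 0).
rewrite /lincomb -(@sum_cat_trunc _ s t (fun i => b (k i) * s`_i)); apply: eq_bigr => i _.
by rewrite nth_cat; case: ifP; rewrite ?raddf0 ?mul0r.
Qed.

Lemma extend_lin_indep1 s x :
  lin_indep s -> exists2 t, lin_indep (s ++ t) & in_span (s ++ t) x.
Proof.
move=> sP; have [xs|xs] := classic (in_span s x).
  by exists [::]; rewrite cats0.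
exists [:: x]; rewrite cats1; last first.
  exists (fun i => (i == size s)%:R); rewrite lincomb_rcons eqxx rmorph1 mul1r.
  rewrite /lincomb big1_seq ?add0r // => i.
  by rewrite mem_index_iota => /andP[_ lti]; rewrite ltn_eqF // raddf0 mul0r.
move=> k; rewrite lincomb_rcons => k0; have [ks|ks] := eqVneq (k (size s)) 0.
  move: k0; rewrite ks rmorph0 mul0r addr0 => /sP k0 i.
  by rewrite size_rcons ltnS leq_eqVlt => /orP[/eqP->|/k0].
case: xs; exists (fun i => - (k (size s))^-1 * k i).
have bks : b (k (size s)) != 0 by rewrite fmorph_eq0.
apply: (mulfI bks); move/eqP: k0; rewrite addrC addr_eq0 => /eqP ->.
rewrite /lincomb mulr_sumr -sumrN; apply: eq_bigr => i _.
by rewrite rmorphM rmorphN fmorphV; field.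
Qed.

(** An independent family extends to one that spans a given finite set. *)
Lemma extend_lin_indep s t :
  lin_indep s -> exists2 s', lin_indep (s ++ s') & forall x, x \in t -> in_span (s ++ s') x.
Proof.
elim: t s => [|x t IH] s sP; first by exists [::]; rewrite ?cats0.
have [u su xu] := extend_lin_indep1 x sP.
have [v uv tv] := IH _ su; exists (u ++ v); rewrite catA //.
by move=> y; rewrite inE => /orP[/eqP->|/tv //]; apply: in_span_cat.
Qed.

Section Polynomials.

Variable n : nat.
Implicit Types (p D : {mpoly K[n]}) (G : {mpoly E[n]}) (R T : nat -> {mpoly K[n]}).

(** The polynomial over [E] obtained by combining the polynomials [R i] over [K]
    with the entries of [s] as coefficients. *)
Definition mlincomb s R : {mpoly E[n]} :=
  \sum_(0 <= i < size s) s`_i *: map_mpoly b (R i).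

Lemma mlincomb_eq0 s R : lin_indep s -> mlincomb s R = 0 ->
  forall i, (i < size s)%N -> R i = 0.
Proof.
move=> sP R0 i lti; apply/mpolyP => m; rewrite mcoeff0.
apply: (sP (fun i => (R i)@_m)) => //.
rewrite -[RHS](mcoeff0 _ m) -R0 /mlincomb raddf_sum /=; apply: eq_bigr => j _.
by rewrite mcoeffZ mcoeff_map_mpoly mulrC.
Qed.

(** The coefficient polynomials are determined by the combination, also after
    the family of scalars has been extended. *)
Lemma mlincomb_inj s t R T : lin_indep (s ++ t) ->
  mlincomb s R = mlincomb (s ++ t) T -> forall i, (i < size s)%N -> R i = T i.
Proof.
move=> stP RT i lti; apply/eqP; rewrite -subr_eq0; apply/eqP.
pose R' i := (if (i < size s)%N then R i else 0) - T i.
suff : R' i = 0 by rewrite /R' lti.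
apply: (@mlincomb_eq0 (s ++ t)) => //; last by rewrite size_cat ltn_addr.
suff -> : mlincomb (s ++ t) R' = mlincomb s R - mlincomb (s ++ t) T.
  by rewrite RT subrr.
rewrite /mlincomb -(@sum_cat_trunc _ s t (fun i => s`_i *: map_mpoly b (R i))) -sumrB.
apply: eq_bigr => j _; rewrite /R' raddfB /= scalerBr; congr (_ - _).
by rewrite nth_cat; case: ifP; rewrite ?raddf0 ?scaler0.
Qed.

Lemma mpoly_in_span s G : (forall m, in_span s G@_m) -> exists T, G = mlincomb s T.
Proof.
move=> Gs; rewrite [G]mpolyE.
elim/big_ind: _ => [|_ _ [R ->] [T ->]|m _].
- by exists (fun=> 0); rewrite /mlincomb big1 // => i _; rewrite raddf0 scaler0.
- exists (fun i => R i + T i); rewrite /mlincomb -big_split; apply: eq_bigr => i _.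
  by rewrite raddfD /= scalerDr.
have [k ->] := Gs m; exists (fun i => k i *: 'X_[m]).
rewrite /lincomb scaler_suml; apply: eq_bigr => i _.
by rewrite map_mpolyZ map_mpolyX scalerA mulrC.
Qed.

(** If a polynomial over [K] divides, over [E], a combination of polynomials
    over [K] with independent coefficients, it divides each of them over [K]. *)
Lemma divides_mlincomb s R D G : lin_indep s ->
  mlincomb s R = G * map_mpoly b D ->
  forall i, (i < size s)%N -> mpoly_divides D (R i).
Proof.
move=> sP RG i lti.
have [t stP Gt] := extend_lin_indep [seq G@_m | m <- msupp G] sP.
have [m|T GE] := @mpoly_in_span (s ++ t) G.
  have [/(map_f (fun m => G@_m))/Gt //|/memN_msupp_eq0->] := boolP (m \in msupp G).
  by exists (fun=> 0); rewrite /lincomb big1 // => j _; rewrite raddf0 mul0r.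
exists (T i); apply: (@mlincomb_inj s t R (fun i => T i * D)) => //.
rewrite RG GE /mlincomb mulr_suml; apply: eq_bigr => j _.
by rewrite rmorphM /= scalerAl.
Qed.

(** If a combination of polynomials over [K] with independent coefficients
    lies in the [E]-span of two polynomials over [K], each of them lies in
    their [K]-span. *)
Lemma span_mlincomb s R (x y : E) (p q : {mpoly K[n]}) : lin_indep s ->
  mlincomb s R = x *: map_mpoly b p + y *: map_mpoly b q ->
  forall i, (i < size s)%N -> exists al be, R i = al *: p + be *: q.
Proof.
move=> sP RE i lti.
have [t stP xyt] := extend_lin_indep [:: x; y] sP.
have [|k xE] := xyt x; first by rewrite inE eqxx.
have [|h yE] := xyt y; first by rewrite !inE eqxx orbT.
exists (k i), (h i); apply: (@mlincomb_inj s t R (fun i => k i *: p + h i *: q)) => //.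
rewrite RE xE yE /lincomb !scaler_suml -big_split; apply: eq_bigr => j _.
by rewrite raddfD /= !map_mpolyZ scalerDr !scalerA mulrC [b (h j) * _]mulrC.
Qed.

End Polynomials.
End LinearDescent.

(** * Binary forms *)

Section BinaryForms.

Variable E : closedFieldType.
Local Notation U := ('X_ord0 : {mpoly E[2]}).
Local Notation V := ('X_ord_max : {mpoly E[2]}).
Implicit Types (p q : {poly E}) (H : {mpoly E[2]}) (s : seq E).

(** The form of degree [d] in [U] and [V] whose value at [V = 1] is [p], for [p]
    of degree at most [d]. *)
Definition homogenize d p : {mpoly E[2]} :=
  \sum_(0 <= i < d.+1) p`_i *: (U ^+ i * V ^+ (d - i)).

Lemma homogenizeB d p q : homogenize d (p - q) = homogenize d p - homogenize d q.
Proof. by rewrite /homogenize -sumrB; apply: eq_bigr => i _; rewrite coefB scalerBl. Qed.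

Lemma homogenizeZ d c p : homogenize d (c *: p) = c *: homogenize d p.
Proof. by rewrite /homogenize scaler_sumr; apply: eq_bigr => i _; rewrite coefZ scalerA. Qed.

Lemma homogenizeXM d p : homogenize d.+1 ('X * p) = U * homogenize d p.
Proof.
rewrite /homogenize big_nat_recl // coefXM scale0r add0r mulr_sumr.
by apply: eq_bigr => i _; rewrite coefXM /= subSS exprS -scalerAr mulrA.
Qed.

Lemma homogenizeS d p :
  (size p <= d.+1)%N -> homogenize d.+1 p = V * homogenize d p.
Proof.
move=> sp; rewrite /homogenize big_nat_recr //= nth_default // scale0r addr0 mulr_sumr.
by apply: eq_big_nat => i /= lti; rewrite subSn // exprS -scalerAr mulrCA.
Qed.

Lemma homogenize_prod d s : (size s <= d)%N ->
  homogenize d (\prod_(r <- s) ('X - r%:P)) =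
  V ^+ (d - size s) * \prod_(r <- s) (U - r *: V).
Proof.
elim: s d => [|r s IH] d.
  move=> _; rewrite !big_nil mulr1 subn0; elim: d => [|d IHd].
    by rewrite /homogenize big_nat1 coef1 !expr0 mulr1 scale1r.
  by rewrite homogenizeS ?size_poly1 // IHd exprS.
case: d => // d /= lts; have := IH d lts; rewrite !big_cons subSS.
set q := \prod_(j <- s) _ => IHd.
rewrite mulrBl homogenizeB homogenizeXM mul_polyC homogenizeZ.
rewrite homogenizeS ?size_prod_XsubC // IHd -!mul_mpolyC.
by ring.
Qed.

Lemma homog_homogenize d H : H \is d.-homog ->
  exists2 p : {poly E}, (size p <= d.+1)%N & H = homogenize d p.
Proof.
move=> Hd; pose mk i j := (U_(ord0 : 'I_2) *+ i + U_(ord_max : 'I_2) *+ j)%MM.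
have mkE i j : U ^+ i * V ^+ j = 'X_[mk i j] by rewrite mpolyXD -!mpolyXn.
have mk0 i j : mk i j ord0 = i by rewrite mnmDE !mulmnE !mnm1E /= mul1n mul0n addn0.
have mk1 i j : mk i j ord_max = j by rewrite mnmDE !mulmnE !mnm1E /= mul1n mul0n.
have mdegE (m : 'X_{1..2}) : mdeg m = (m ord0 + m ord_max)%N.
  rewrite mdegE big_ord_recr big_ord1 /=; congr (m _ + m _)%N; exact: val_inj.
have mkK (m : 'X_{1..2}) : m = mk (m ord0) (m ord_max).
  apply/mnmP => -[[|[|//]] lti].
    by rewrite (_ : Ordinal lti = ord0) ?mk0 //; apply: val_inj.
  by rewrite (_ : Ordinal lti = ord_max) ?mk1 //; apply: val_inj.
exists (\poly_(i < d.+1) H@_(mk i (d - i)%N)); first exact: size_poly.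
apply/mpolyP => m; rewrite /homogenize raddf_sum /=.
rewrite (eq_big_nat _ _ (F2 := fun i => H@_m *+ ((mk i (d - i)%N) == m))); last first.
  move=> i /= lti; rewrite mcoeffZ mkE mcoeffX coef_poly lti.
  by case: eqP => [->|]; rewrite ?mulr1 ?mulr0.
have [md|md] := eqVneq (mdeg m) d; last first.
  by rewrite (dhomog_nemf_coeff Hd md) big1 // => i _; rewrite mul0rn.
have m1 : m ord_max = (d - m ord0)%N by rewrite -md mdegE addKn.
rewrite (bigD1_seq (m ord0)) ?mem_index_iota ?iota_uniq //=; last first.
  by rewrite ltnS -md mdegE leq_addr.
rewrite -m1 -mkK eqxx mulr1n big1 ?addr0 // => i ni.
by case: eqP => // mE; rewrite -mE mk0 eqxx in ni.
Qed.

(** Over an algebraically closed field a nonzero binary form is a product of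
    linear forms. *)
Theorem binary_form_factor d H : H \is d.-homog -> H != 0 ->
  exists c k s, c != 0 /\ H = c *: (V ^+ k * \prod_(r <- s) (U - r *: V)).
Proof.
move=> /homog_homogenize[p sp HE] H0.
have p0 : p != 0.
  apply: contraNneq H0 => p0; rewrite HE p0 /homogenize big1 // => i _.
  by rewrite coef0 scale0r.
have [s pE] := closed_field_poly_normal p.
have lp : lead_coef p != 0 by rewrite lead_coef_eq0.
exists (lead_coef p), (d - size s)%N, s; split=> //.
rewrite HE {1}pE homogenizeZ homogenize_prod //.
by move: sp; rewrite {1}pE size_scale // size_prod_XsubC ltnS.
Qed.

End BinaryForms.

Lemma comp_mpoly_factored (E : fieldType) n c k (s : seq E) (p q : {mpoly E[n]}) :
  (c *: ('X_ord_max ^+ k * \prod_(r <- s) ('X_ord0 - r *: 'X_ord_max))) \mPo [tuple p; q] =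
  c *: (q ^+ k * \prod_(r <- s) (p - r *: q)).
Proof.
rewrite comp_mpolyZ rmorphM rmorphXn rmorph_prod /= comp_mpolyXU /=; congr (_ *: (_ * _)).
by apply: eq_bigr => r _; rewrite rmorphB /= comp_mpolyZ !comp_mpolyXU.
Qed.

(** * Pencils *)

Lemma mpoly_constP (k : fieldType) n (p : {mpoly k[n]}) :
  const_mpoly p <-> forall m, m != 0%MM -> p@_m = 0.
Proof.
split=> [/msize1_polyC -> m m0|p0]; first by rewrite mcoeffC (negPf m0) mulr0.
rewrite /const_mpoly (_ : p = (p@_0)%:MP) ?msizeC ?leq_b1 //.
apply/mpolyP => m; rewrite mcoeffC; have [->|m0] := eqVneq m 0%MM; first by rewrite mulr1.
by rewrite mulr0 p0.
Qed.

Lemma mpoly_unit_const (k : fieldType) n (p : {mpoly k[n]}) :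
  (p \is a GRing.unit) = (p != 0) && const_mpoly p.
Proof.
apply/idP/andP => [pU|[p0 /msize1_polyC pE]].
  split; first by apply: contraTneq pU => ->; rewrite unitr0.
  by have /andP[/eqP -> _] := pU; rewrite /const_mpoly msizeC leq_b1.
rewrite pE; apply: rmorph_unit; rewrite unitfE.
by apply: contraNneq p0 => c0; rewrite pE c0 mpolyC0.
Qed.

Lemma mpoly_nonunit_coef (k : fieldType) n (p : {mpoly k[n]}) :
  p != 0 -> p \isn't a GRing.unit -> exists2 m, m != 0%MM & p@_m != 0.
Proof.
rewrite mpoly_unit_const => -> /= /negP pC; apply: NNPP => nex; apply/pC/mpoly_constP.
by move=> m m0; apply/eqP/contraT => pm; case: nex; exists m.
Qed.

(** [r] lies outside the base field embedded by [b]. *)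
Definition outside (K E : fieldType) (b : {rmorphism K -> E}) (r : E) : Prop :=
  forall x, r <> b x.

(** The base field being algebraically closed, its elements are the only
    algebraic ones. *)
Lemma outside_transcendental (K : closedFieldType) (E : fieldType)
    (b : {rmorphism K -> E}) (r : E) (p : {poly K}) :
  outside b r -> (map_poly b p).[r] = 0 -> p = 0.
Proof.
move=> rb; have [s pE] := closed_field_poly_normal p.
rewrite pE map_polyZ hornerZ rmorph_prod /= horner_prod => /eqP.
rewrite mulf_eq0 => /orP[|]; first by rewrite fmorph_eq0 => /eqP->; rewrite scale0r.
rewrite prodf_seq_eq0 => /hasP[x _ /=].
by rewrite rmorphB /= map_polyX map_polyC !hornerE subr_eq0 => /eqP/rb.
Qed.

(** [1] and [r] are linearly independent over the base field. *)
Lemma outside_indep (K E : fieldType) (b : {rmorphism K -> E}) (r : E) (x y : K) :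
  outside b r -> b x - r * b y = 0 -> x = 0 /\ y = 0.
Proof.
move=> rb /eqP; rewrite subr_eq0 => /eqP E0; have [y0|y0] := eqVneq y 0.
  split=> //; apply/eqP; rewrite -(fmorph_eq0 b) E0 y0 rmorph0 mulr0; exact: eqxx.
case: (rb (x / y)); rewrite fmorph_div E0 mulfK // fmorph_eq0; exact: y0.
Qed.

(** The member [phi - r psi] of a pencil, over an extension of the base field. *)
Definition pencil (K E : fieldType) (b : {rmorphism K -> E}) n
    (phi psi : {mpoly K[n]}) (r : E) : {mpoly E[n]} :=
  map_mpoly b phi - r *: map_mpoly b psi.

Lemma mcoeff_pencil (K E : fieldType) (b : {rmorphism K -> E}) n
    (phi psi : {mpoly K[n]}) r m :
  (pencil b phi psi r)@_m = b phi@_m - r * b psi@_m.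
Proof. by rewrite mcoeffB mcoeffZ !mcoeff_map_mpoly. Qed.

(** A polynomial whose coefficients lie in the image of [I] lifts along [I]. *)
Lemma mpoly_lift (C : idomainType) (E : fieldType) (I : {rmorphism C -> E}) n
    (p : {mpoly E[n]}) :
  (forall m, m \in msupp p -> exists y, I y = p@_m) -> exists q, p = map_mpoly I q.
Proof.
move=> pI; rewrite [p]mpolyE big_seq.
elim/big_ind: _ => [|_ _ [q ->] [q' ->]|m /pI[y <-]].
- by exists 0; rewrite raddf0.
- by exists (q + q'); rewrite raddfD.
by exists (y *: 'X_[m]); rewrite map_mpolyZ map_mpolyX.
Qed.

(** Irreducibility of the generic member of a pencil does not depend on the
    transcendental parameter: a factorization for one parameter specializes
    to a factorization for the other. *)
Theorem pencil_irreducible (K E M : closedFieldType) (b : {rmorphism K -> E})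
    (b' : {rmorphism K -> M}) n (phi psi : {mpoly K[n]}) (r : E) (t : M) :
  outside b r -> outside b' t -> irreducible_mpoly (pencil b' phi psi t) ->
  irreducible_mpoly (pencil b phi psi r).
Proof.
move=> rb tb [t0 tU tirr].
have transfer m : (pencil b phi psi r)@_m = 0 -> (pencil b' phi psi t)@_m = 0.
  rewrite !mcoeff_pencil => /(outside_indep rb)[-> ->].
  by rewrite !raddf0 mulr0 subr0.
split.
- apply: contraNneq t0 => r0; apply/eqP/mpolyP => m.
  by rewrite mcoeff0 transfer // r0 mcoeff0.
- apply: contra tU; rewrite !mpoly_unit_const t0 => /andP[_ /mpoly_constP rC].
  by apply/mpoly_constP => m /rC/transfer.
move=> q s qsE; apply: NNPP => /not_or_and[/negP qU /negP sU].
have r0 : pencil b phi psi r != 0.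
  apply: contraNneq t0 => r0; apply/eqP/mpolyP => m.
  by rewrite mcoeff0 transfer // r0 mcoeff0.
have [q0 s0] : q != 0 /\ s != 0 by apply/andP; rewrite -negb_or -mulf_eq0 -qsE.
have [m m0 qm] := mpoly_nonunit_coef q0 qU.
have [m' m'0 sm'] := mpoly_nonunit_coef s0 sU.
(* [i] and [j] embed [K[X]] by sending [X] to the two transcendental
   parameters; avoiding the zeros of a nonconstant coefficient of each factor
   keeps the specialized factors nonconstant. *)
pose i : {rmorphism {poly K} -> E} := horner_eval r \o map_poly b.
pose j : {rmorphism {poly K} -> M} := horner_eval t \o map_poly b'.
pose cs := [seq q@_m | m <- msupp q] ++ [seq s@_m | m <- msupp s].
have [C [e [I [Ie Ics IJ]]]] := specialize_finite i cs.
have [q1 q1E] : exists q1, q = map_mpoly I q1.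
  by apply: mpoly_lift => k /(map_f (fun k => q@_k)) kq; apply: Ics; rewrite mem_cat kq.
have [s1 s1E] : exists s1, s = map_mpoly I s1.
  by apply: mpoly_lift => k /(map_f (fun k => s@_k)) ks; apply: Ics; rewrite mem_cat ks orbT.
have [|a ia aP] := IJ (q1@_m * s1@_m').
  by rewrite rmorphM /= -!mcoeff_map_mpoly -q1E -s1E mulf_neq0.
have iker x : i x = 0 -> x = 0 by apply: outside_transcendental.
have [|| J [Je JI]] := aP M j.
- by move=> x /iker ->; rewrite rmorph0.
- by apply: contraNneq ia => /(outside_transcendental tb) ->; rewrite rmorph0.
rewrite rmorphM mulf_eq0 => /norP[Jq Js].
have [] := tirr (map_mpoly J q1) (map_mpoly J s1).
- apply/mpolyP => k; rewrite -rmorphM /= mcoeff_map_mpoly mcoeff_pencil.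
  pose c := (phi@_k)%:P - 'X * (psi@_k)%:P.
  have iE : i c = b phi@_k - r * b psi@_k.
    rewrite /i /= /horner_eval rmorphB rmorphM /= !map_polyC map_polyX.
    by rewrite !hornerE.
  have jE : j c = b' phi@_k - t * b' psi@_k.
    rewrite /j /= /horner_eval rmorphB rmorphM /= !map_polyC map_polyX.
    by rewrite !hornerE.
  apply/eqP; rewrite -jE -Je eq_sym -subr_eq0 -rmorphB; apply/eqP/JI.
  rewrite rmorphB /= Ie iE -mcoeff_pencil qsE q1E s1E -rmorphM /=.
  by rewrite mcoeff_map_mpoly subrr.
- rewrite mpoly_unit_const => /andP[_ /mpoly_constP/(_ m m0)].
  by rewrite mcoeff_map_mpoly; apply/eqP.
rewrite mpoly_unit_const => /andP[_ /mpoly_constP/(_ m' m'0)].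
by rewrite mcoeff_map_mpoly; apply/eqP.
Qed.

(** The two generators of a pencil with an irreducible generic member stay
    linearly independent over the extension. *)
Lemma pencil_free (K E : fieldType) (b : {rmorphism K -> E}) n
    (phi psi : {mpoly K[n]}) (r x y : E) :
  relatively_prime [:: phi; psi] -> irreducible_mpoly (pencil b phi psi r) ->
  x *: map_mpoly b phi + y *: map_mpoly b psi = 0 -> x = 0 /\ y = 0.
Proof.
move=> prim [r0 rU _].
have nC : ~ (const_mpoly phi /\ const_mpoly psi).
  case=> /mpoly_constP phiC /mpoly_constP psiC; case/negP: rU.
  rewrite mpoly_unit_const r0; apply/mpoly_constP => m m0.
  by rewrite mcoeff_pencil phiC // psiC // !raddf0 mulr0 subr0.
have nz : ~ (phi = 0 /\ psi = 0).
  by case=> p0 q0; apply: nC; rewrite p0 q0 /const_mpoly msize0.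
have constZ z (p : {mpoly K[n]}) : const_mpoly p -> const_mpoly (z *: p).
  by move=> /mpoly_constP pC; apply/mpoly_constP => m m0; rewrite mcoeffZ pC ?mulr0.
have nphi z : phi <> z *: psi.
  move=> pE; have psiC : const_mpoly psi.
    apply: prim => p; rewrite !inE => /orP[]/eqP->; last by exists 1; rewrite mul1r.
    by exists z%:MP; rewrite mul_mpolyC.
  by apply: nC; rewrite {1}pE; split=> //; apply: constZ.
have npsi : psi <> 0.
  move=> psi0; apply: nC; rewrite psi0 {2}/const_mpoly msize0; split=> //.
  apply: prim => p; rewrite !inE => /orP[]/eqP->; first by exists 1; rewrite mul1r.
  by exists 0; rewrite mul0r.
move=> E0; have [x0|x0] := eqVneq x 0.
  split=> //; apply/eqP/contraT => y0; case: npsi; apply/mpolyP => m.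
  move/(congr1 (mcoeff m))/eqP: E0; rewrite x0 scale0r add0r mcoeffZ mcoeff_map_mpoly.
  by rewrite !mcoeff0 mulf_eq0 (negPf y0) fmorph_eq0 => /eqP.
(* The relation reads phi = z psi with z = - y / x, which is impossible both for
   z outside the base field and for z inside. *)
have cE m : b phi@_m - (- (y / x)) * b psi@_m = 0.
  move/(congr1 (mcoeff m)): E0; rewrite mcoeffD !mcoeffZ !mcoeff_map_mpoly mcoeff0 => E1.
  by apply: (mulfI x0); rewrite mulr0 -[RHS]E1; field.
have [out|] := classic (outside b (- (y / x))).
  case: nz; split; apply/mpolyP => m; rewrite mcoeff0.
    by have [] := outside_indep out (cE m).
  by have [] := outside_indep out (cE m).
move=> /not_all_ex_not[z /NNPP zE]; case: (nphi z); apply/mpolyP => m.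
apply: (fmorph_inj b); have /eqP := cE m.
by rewrite zE -rmorphM subr_eq0 mcoeffZ => /eqP.
Qed.

(** * Unique factorization into members of a pencil *)

Lemma prime_divides_prod (R : idomainType) (T : eqType) (p : R) (s : seq T) (f : T -> R) :
  prime_elt p -> divides p (\prod_(x <- s) f x) -> exists2 x, x \in s & divides p (f x).
Proof.
case=> p0 pU pD; elim: s => [|x s IH].
  rewrite big_nil => -[q E]; case/negP: pU; apply/unitrP.
  by exists q; rewrite [p * q]mulrC E.
rewrite big_cons => /pD[pfx|/IH[y ys pfy]]; first by exists x; rewrite ?mem_head.
by exists y => //; rewrite inE ys orbT.
Qed.

Lemma divides_scaler (k : fieldType) n (p q : {mpoly k[n]}) c :
  c != 0 -> divides p (c *: q) -> divides p q.
Proof.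
move=> c0 [d E]; exists (c^-1 *: d).
by rewrite -scalerAl -E scalerA mulVf // scale1r.
Qed.

(** Divisibility between members of a pencil whose generators are independent
    forces equality of the parameters. *)
Lemma pencil_prime_inj (K E : fieldType) (b : {rmorphism K -> E}) n
    (phi psi : {mpoly K[n]}) (r t : E) :
  (forall x y, x *: map_mpoly b phi + y *: map_mpoly b psi = 0 -> x = 0 /\ y = 0) ->
  prime_elt (pencil b phi psi r) -> prime_elt (pencil b phi psi t) ->
  divides (pencil b phi psi r) (pencil b phi psi t) -> r = t.
Proof.
move=> free rP tP /(prime_dvd_prime rP tP)[u].
rewrite mpoly_unit_const => /andP[_ /msize1_polyC ->]; rewrite mul_mpolyC.
set c := u@_0 => cE; have [] := free (1 - c) (c * r - t).
  move/eqP: cE; rewrite -subr_eq0 /pencil => /eqP E0; rewrite -[RHS]E0.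
  by rewrite -!mul_mpolyC !(rmorphB, rmorphM, rmorph1) /=; ring.
by move/eqP; rewrite subr_eq0 => /eqP <-; rewrite mul1r => /eqP; rewrite subr_eq0 => /eqP.
Qed.

(** Products of prime members of one pencil coincide only if they have the same
    constants and the same parameters. *)
Lemma pencil_unique_factorization (K E : fieldType) (b : {rmorphism K -> E}) n
    (phi psi : {mpoly K[n]}) (s t : seq E) (x y : E) :
  (forall x y, x *: map_mpoly b phi + y *: map_mpoly b psi = 0 -> x = 0 /\ y = 0) ->
  (forall r, r \in s -> prime_elt (pencil b phi psi r)) ->
  (forall r, r \in t -> prime_elt (pencil b phi psi r)) ->
  x != 0 -> y != 0 ->
  x *: \prod_(r <- s) pencil b phi psi r = y *: \prod_(r <- t) pencil b phi psi r ->
  x = y /\ perm_eq s t.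
Proof.
move=> free + + x0 y0; elim: s t => [|r s IH] t sP tP.
  case: t tP => [_|r t tP].
    rewrite !big_nil => /(congr1 (mcoeff 0%MM)).
    by rewrite !mcoeffZ mcoeff1 eqxx !mulr1.
  rewrite big_nil big_cons => E0; have [_ /negP[]] := tP r (mem_head _ _).
  have : x *: 1 \is a @GRing.unit {mpoly E[n]}.
    by rewrite -mul_mpolyC mulr1; apply: rmorph_unit; rewrite unitfE.
  by rewrite E0 scalerAr unitrM => /andP[].
move=> E0; have rP := sP r (mem_head _ _).
have [|r' r't rr'] := @prime_divides_prod _ _ _ t (pencil b phi psi) rP.
  apply: (divides_scaler y0); rewrite -E0 big_cons.
  by exists (x *: \prod_(j <- s) pencil b phi psi j); rewrite -scalerAl mulrC.
have rE := pencil_prime_inj free rP (tP r' r't) rr'; rewrite -{r' rr'}rE in r't.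
have pt := perm_to_rem r't; have [||| -> st] := IH (rem r t).
- by move=> r' r's; apply: sP; rewrite inE r's orbT.
- by move=> r' /mem_rem/tP.
- have [r0 _ _] := rP; apply: (mulfI r0); rewrite -!scalerAr.
  by move: E0; rewrite (perm_big _ pt) !big_cons.
by split=> //; rewrite perm_sym (permPl pt) perm_cons perm_sym.
Qed.

(** * The linear family *)

HB.instance Definition _ (K : fieldType) l (Om : closedFieldType)
    (iota : {rmorphism {fraction {mpoly K[l]}} -> Om}) :=
  GRing.RMorphism.copy (of_params iota) (iota \o @tofrac {mpoly K[l]}).

HB.instance Definition _ (K : fieldType) l (Om : closedFieldType)
    (iota : {rmorphism {fraction {mpoly K[l]}} -> Om}) :=
  GRing.RMorphism.copy (of_base iota) (of_params iota \o @mpolyC l K).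

Section LinearFamily.

Variables (K : closedFieldType) (n l : nat) (Om : closedFieldType).
Variable iota : {rmorphism {fraction {mpoly K[l]}} -> Om}.
Variables (P : {mpoly K[n]}) (Q : 'I_l -> {mpoly K[n]}).

Local Notation F := (map_mpoly (of_params iota) (linear_family P Q)).
Local Notation params := (1 :: codom (fun i : 'I_l => of_params iota 'X_i)).
Local Notation members := (P :: codom Q).

Lemma of_params_inj : injective (of_params iota).
Proof. by move=> p q /fmorph_inj/eqP; rewrite tofrac_eq => /eqP. Qed.

Lemma nth_codom_ord (T : Type) (x0 : T) (f : 'I_l -> T) (i : 'I_l) :
  nth x0 (codom f) i = f i.
Proof. by rewrite (nth_map i) ?size_enum_ord // nth_ord_enum. Qed.

Lemma size_params : size params = l.+1.
Proof. by rewrite /= size_codom card_ord. Qed.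

(** The family is the combination of its members [P, Q_1, ..., Q_l] with
    coefficients [1, lambda_1, ..., lambda_l]. *)
Lemma linear_family_mlincomb : F = mlincomb (of_base iota) params (nth 0 members).
Proof.
rewrite /mlincomb size_params big_nat_recl // big_mkord rmorphD /= scale1r.
have mapC p : map_mpoly (of_params iota) (map_mpoly (@mpolyC l K) p) =
    map_mpoly (of_base iota) p :> {mpoly Om[n]}.
  by apply/mpolyP => m; rewrite !mcoeff_map_mpoly.
rewrite mapC raddf_sum; congr (_ + _); apply: eq_bigr => i _ /=.
by rewrite map_mpolyZ /= mapC !nth_codom_ord.
Qed.

(** [1, lambda_1, ..., lambda_l] are linearly independent over [K]. *)
Lemma params_indep : lin_indep (of_base iota) params.
Proof.
move=> k; rewrite /lincomb size_params big_nat_recl // big_mkord /= mulr1 => k0.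
have {k0} : (k 0)%:MP + \sum_(i < l) k i.+1 *: 'X_i = 0 :> {mpoly K[l]}.
  apply: of_params_inj; rewrite rmorph0 -[RHS]k0 rmorphD rmorph_sum /=; congr (_ + _).
  by apply: eq_bigr => i _; rewrite nth_codom_ord -mul_mpolyC rmorphM.
move=> E0 [_|i].
  move/(congr1 (mcoeff 0%MM)): E0; rewrite mcoeffD mcoeffC eqxx mulr1 mcoeff0.
  rewrite raddf_sum big1 ?addr0 // => i _ /=.
  by rewrite mcoeffZ mcoeffX -mdeg_eq0 mdeg1 mulr0.
rewrite ltnS => lti.
move/(congr1 (mcoeff U_(Ordinal lti))): E0.
rewrite mcoeffD mcoeffC -mdeg_eq0 mdeg1 mulr0 add0r mcoeff0 raddf_sum.
rewrite (bigD1 (Ordinal lti)) //= mcoeffZ mcoeffXU eqxx mulr1 big1 ?addr0 //.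
by move=> j nj; rewrite mcoeffZ mcoeffXU (negPf nj) mulr0.
Qed.

(** A polynomial over [K] that divides the family over [Om] is constant. *)
Lemma linear_family_coprime (D : {mpoly K[n]}) G :
  relatively_prime members -> F = G * map_mpoly (of_base iota) D -> const_mpoly D.
Proof.
move=> prim; rewrite linear_family_mlincomb => FD; apply: prim => p pm.
rewrite -(nth_index 0 pm); apply: (divides_mlincomb params_indep FD).
by rewrite size_params; move: pm; rewrite -index_mem /= size_codom card_ord.
Qed.

Lemma linear_family_nonconst :
  ~ (const_mpoly P /\ forall i, const_mpoly (Q i)) -> ~ const_mpoly F.
Proof.
move=> nC /mpoly_constP FC; apply: nC.
have C i : (i < l.+1)%N -> const_mpoly (nth 0 members i).
  move=> lti; apply/mpoly_constP => m m0.
  apply: (params_indep (k := fun i => (nth 0 members i)@_m)); last by rewrite size_params.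
  rewrite -(FC m m0) linear_family_mlincomb /mlincomb raddf_sum.
  by apply: eq_bigr => j _; rewrite /= mcoeffZ mcoeff_map_mpoly mulrC.
split=> [|i]; first exact: (C 0%N).
by have := C i.+1 (ltn_ord i); rewrite /= nth_codom_ord.
Qed.

(** * Decompositions of the linear family *)

(** The factorization of a decomposition into members of the pencil; the
    members defined over the base field are constant. *)
Lemma decomposition_factor phi psi H d :
  homogeneous_decomposition iota (linear_family P Q) phi psi H d ->
  relatively_prime members -> F != 0 ->
  exists c k s, [/\ c != 0,
    H = c *: ('X_ord_max ^+ k * \prod_(r <- s) ('X_ord0 - r *: 'X_ord_max)),
    F = c *: (map_mpoly (of_base iota) psi ^+ k *
              \prod_(r <- s) pencil (of_base iota) phi psi r),
    (0 < k)%N -> const_mpoly psi &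
    forall x, of_base iota x \in s -> const_mpoly (phi - x *: psi)].
Proof.
case=> _ _ Hd FE prim F0.
have H0 : H != 0 by apply: contraNneq F0 => H0; rewrite FE H0 raddf0.
have [c [k [s [c0 HE]]]] := binary_form_factor Hd H0.
exists c, k, s; have FE' := FE; rewrite HE comp_mpoly_factored in FE'; split=> //.
  case: k {HE} FE' => // k FE' _.
  set G := \prod_(r <- s) _ in FE'.
  apply: (@linear_family_coprime _ (c *: (map_mpoly (of_base iota) psi ^+ k * G))) => //.
  by rewrite FE' exprSr -!scalerAl mulrAC.
move=> x xs.
apply: (@linear_family_coprime _ (c *: (map_mpoly (of_base iota) psi ^+ k *
  \prod_(r <- rem (of_base iota x) s) pencil (of_base iota) phi psi r))) => //.
rewrite FE' (perm_big _ (perm_to_rem xs)) big_cons -scalerAl raddfB /= map_mpolyZ.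
by rewrite -/(pencil _ _ _ _) -[in RHS]mulrA [in RHS]mulrC -[in RHS]mulrA mulrCA mulrC mulrA.
Qed.

Lemma const_mpoly_map (b : {rmorphism K -> Om}) (p : {mpoly K[n]}) :
  const_mpoly p -> const_mpoly (map_mpoly b p).
Proof.
by move=> /mpoly_constP pC; apply/mpoly_constP => m m0; rewrite mcoeff_map_mpoly pC ?raddf0.
Qed.

Lemma pencil_base (b : {rmorphism K -> Om}) (phi psi : {mpoly K[n]}) x :
  pencil b phi psi (b x) = map_mpoly b (phi - x *: psi).
Proof. by rewrite raddfB /= map_mpolyZ. Qed.

Lemma const_mpolyM (p q : {mpoly Om[n]}) : const_mpoly p -> const_mpoly q -> const_mpoly (p * q).
Proof.
move=> /msize1_polyC -> /msize1_polyC ->.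
by rewrite -mpolyCM /const_mpoly msizeC leq_b1.
Qed.

Lemma not_const_prime (p q : {mpoly Om[n]}) :
  prime_elt p -> q != 0 -> const_mpoly q -> ~ divides p q.
Proof.
move=> [_ pU _] q0 qC [u E]; case/negP: pU.
have : q \is a GRing.unit by rewrite mpoly_unit_const q0.
by rewrite E unitrM => /andP[].
Qed.

(** A prime factor of the family divides a member of the pencil that is not
    defined over the base field. *)
Lemma decomposition_prime_divisor phi psi c k s (A : {mpoly Om[n]}) :
  F != 0 -> c != 0 ->
  F = c *: (map_mpoly (of_base iota) psi ^+ k *
            \prod_(r <- s) pencil (of_base iota) phi psi r) ->
  ((0 < k)%N -> const_mpoly psi) ->
  (forall x, of_base iota x \in s -> const_mpoly (phi - x *: psi)) ->
  prime_elt A -> divides A F ->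
  exists r, [/\ r \in s, outside (of_base iota) r & divides A (pencil (of_base iota) phi psi r)].
Proof.
move=> F0 c0 FE kC sC AP; rewrite FE => /(divides_scaler c0).
have [_ _ AD] := AP; have := F0; rewrite FE scaler_eq0 (negPf c0).
rewrite mulf_eq0 => /norP[_ /norP[psi0 prod0]].
case/AD => [Apsi|/(prime_divides_prod AP)[r rs Ar]].
  have [k0|k0] := posnP k.
    by case: (not_const_prime AP psi0) => //; rewrite k0 expr0 /const_mpoly msize1.
  case: (not_const_prime AP psi0) => //.
  have psiC := const_mpoly_map (of_base iota) (kC k0).
  elim: (k) => [|j IH]; first by rewrite expr0 /const_mpoly msize1.
  by rewrite exprS; apply: const_mpolyM.
exists r; split=> // x rE.
have r0 : pencil (of_base iota) phi psi r != 0.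
  by apply: contraNneq prod0 => r0; rewrite prodf_seq_eq0; apply/hasP; exists r => //=; rewrite r0.
apply: (not_const_prime AP r0) Ar; rewrite rE pencil_base; apply: const_mpoly_map.
by apply: sC; rewrite -rE.
Qed.

(** As the family is not constant, some factor is a member of the pencil that is
    not defined over the base field. *)
Lemma decomposition_outside phi psi c k s :
  ~ const_mpoly F ->
  F = c *: (map_mpoly (of_base iota) psi ^+ k *
            \prod_(r <- s) pencil (of_base iota) phi psi r) ->
  ((0 < k)%N -> const_mpoly psi) ->
  (forall x, of_base iota x \in s -> const_mpoly (phi - x *: psi)) ->
  exists2 r, r \in s & outside (of_base iota) r.
Proof.
move=> nC FE kC sC; apply: NNPP => nex; apply: nC; rewrite FE -mul_mpolyC.
have one : const_mpoly (1 : {mpoly Om[n]}) by rewrite /const_mpoly msize1.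
apply: const_mpolyM; first by rewrite /const_mpoly msizeC leq_b1.
apply: const_mpolyM.
  case: (k) kC => // j /(_ isT)/(const_mpoly_map (of_base iota)) psiC.
  by elim: j.+1 => // i IH; rewrite exprS; apply: const_mpolyM.
rewrite big_seq; elim/big_ind: _ => // [p q|r rs]; first exact: const_mpolyM.
have [x rE] : exists x, r = of_base iota x.
  by apply: NNPP => nx; apply: nex; exists r => // x rE; apply: nx; exists x.
by rewrite rE pencil_base; apply/const_mpoly_map/sC; rewrite -rE.
Qed.

(** A reduced decomposition only involves members that are not defined over
    the base field. *)
Lemma reduced_decomposition_outside (phi psi : {mpoly K[n]}) (c : Om) k (s : seq Om) :
  reduced_decomposition iota phi psi
    (c *: ('X_ord_max ^+ k * \prod_(r <- s) ('X_ord0 - r *: 'X_ord_max))) ->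
  ((0 < k)%N -> const_mpoly psi) ->
  (forall x, of_base iota x \in s -> const_mpoly (phi - x *: psi)) ->
  k = 0%N /\ forall r, r \in s -> outside (of_base iota) r.
Proof.
move=> red kC sC; split.
  case: k red kC => // k red /(_ isT) psiC.
  suff : ~~ const_mpoly (0 *: phi + 1 *: psi) by rewrite scale0r add0r scale1r psiC.
  apply: red; first by rewrite xpair_eqE oner_eq0 andbF.
  rewrite rmorph0 rmorph1 scale0r add0r scale1r.
  set G := \prod_(r <- s) _; exists (c *: ('X_ord_max ^+ k * G)).
  by rewrite exprSr -!scalerAl mulrAC.
move=> r rs x rE; have xs : of_base iota x \in s by rewrite -rE.
suff : ~~ const_mpoly (1 *: phi + - x *: psi) by rewrite scale1r scaleNr sC.
apply: red; first by rewrite xpair_eqE oner_eq0.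
rewrite rmorph1 rmorphN scale1r scaleNr.
exists (c *: ('X_ord_max ^+ k *
  \prod_(r <- rem (of_base iota x) s) ('X_ord0 - r *: 'X_ord_max))).
rewrite (perm_big _ (perm_to_rem xs)) big_cons -scalerAl /=.
by rewrite -mulrA [X in _ = c *: (_ * X)]mulrC.
Qed.

End LinearFamily.

(** * Uniqueness of maximal decompositions *)

(** Maximality makes every member with parameter outside the base field
    irreducible, over any algebraically closed extension. *)
Lemma maximal_pencil_irreducible (K M E : closedFieldType) n
    (iota1 : {rmorphism {fraction {mpoly K[1]}} -> M}) (b : {rmorphism K -> E})
    (phi psi : {mpoly K[n]}) (r : E) :
  maximal_pencil iota1 phi psi -> outside b r -> irreducible_mpoly (pencil b phi psi r).
Proof.
(* The generic member [phi + lambda psi] has parameter [- lambda]. *)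
move=> phimax rb; pose t : M := of_params iota1 'X_ord0.
apply: (@pencil_irreducible _ _ _ b (of_base iota1) _ _ _ r (- t)) => // [x tE|].
  have : of_params iota1 (- 'X_ord0) = of_params iota1 x%:MP by rewrite rmorphN.
  move/of_params_inj/(congr1 (mcoeff U_(ord0)))/eqP.
  by rewrite mcoeffN mcoeffXU eqxx mcoeffC -mdeg_eq0 mdeg1 mulr0 oppr_eq0 oner_eq0.
suff -> : pencil (of_base iota1) phi psi (- t) =
  map_mpoly (of_params iota1) (linear_family phi (fun=> psi)) by [].
rewrite /pencil scaleNr opprK /linear_family big_ord1 rmorphD /= map_mpolyZ.
by congr (_ + _ *: _); apply/mpolyP => m; rewrite !mcoeff_map_mpoly.
Qed.

(** If an irreducible member of one pencil, with parameter outside the base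
    field, is proportional to a member of a second pencil, the generators of
    the first are combinations of those of the second. *)
Lemma proportional_members_span (K E : fieldType) n (b : {rmorphism K -> E})
    (phi1 psi1 phi2 psi2 : {mpoly K[n]}) (r t c : E) :
  outside b r -> pencil b phi1 psi1 r = c *: pencil b phi2 psi2 t ->
  exists L : 'M[K]_2,
    phi1 = L ord0 ord0 *: phi2 + L ord0 ord_max *: psi2 /\
    psi1 = L ord_max ord0 *: phi2 + L ord_max ord_max *: psi2.
Proof.
move=> rb E0.
have indep : lin_indep b [:: 1; - r].
  move=> k; rewrite /lincomb !big_nat_recl // big_nil /= mulr1 addr0 mulrN mulrC.
  by move=> /(outside_indep rb)[k0 k1] [|[|]].
have spanP : mlincomb b [:: 1; - r] (nth 0 [:: phi1; psi1]) =
    c *: map_mpoly b phi2 + (- (c * t)) *: map_mpoly b psi2.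
  rewrite /mlincomb !big_nat_recl // big_nil /= scale1r addr0 !scaleNr -scalerA -scalerBr.
  exact: E0.
have [al [be phiE]] := span_mlincomb indep spanP (i := 0%N) isT.
have [ga [de psiE]] := span_mlincomb indep spanP (i := 1%N) isT.
exists (\matrix_(i, j) if i == 0 then (if j == 0 then al else be)
                       else (if j == 0 then ga else de)).
by rewrite !mxE.
Qed.

Lemma det_mx2 (R : comNzRingType) (L : 'M[R]_2) :
  \det L = L ord0 ord0 * L ord_max ord_max - L ord0 ord_max * L ord_max ord0.
Proof.
rewrite (expand_det_row _ ord0) big_ord_recr big_ord1 /=.
have -> : widen_ord (leqnSn 1) ord0 = ord0 by apply: val_inj.
rewrite /cofactor !det_mx11 !mxE /= addn0 add0n expr0 expr1 mul1r mulN1r mulrN.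
by congr (_ * L _ _ - _ * L _ _); apply: val_inj.
Qed.

(** Linearly independent combinations of two polynomials come from an invertible
    matrix. *)
Lemma change_of_generators_unit (K : fieldType) n (L : 'M[K]_2)
    (phi1 psi1 phi2 psi2 : {mpoly K[n]}) :
  (forall x y, x *: phi1 + y *: psi1 = 0 -> x = 0 /\ y = 0) ->
  phi1 = L ord0 ord0 *: phi2 + L ord0 ord_max *: psi2 ->
  psi1 = L ord_max ord0 *: phi2 + L ord_max ord_max *: psi2 ->
  L \in unitmx.
Proof.
move=> free phiE psiE; rewrite unitmxE unitfE det_mx2.
set a := L ord0 ord0 in phiE *; set b := L ord0 ord_max in phiE *.
set c := L ord_max ord0 in psiE *; set d := L ord_max ord_max in psiE *.
apply/eqP => det0.
have [|_ b0] := free d (- b).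
  rewrite phiE psiE -[RHS](scale0r phi2) -det0 -!mul_mpolyC.
  by rewrite !(rmorphB, rmorphM, rmorphN) /=; ring.
have [|_ a0] := free (- c) a.
  rewrite phiE psiE -[RHS](scale0r psi2) -det0 -!mul_mpolyC.
  by rewrite !(rmorphB, rmorphM, rmorphN) /=; ring.
have [|/eqP] := free 1 0; last by rewrite oner_eq0.
rewrite phiE a0; move/eqP: b0; rewrite oppr_eq0 => /eqP ->.
by rewrite !scale0r !addr0 scaler0.
Qed.

Lemma lin_act2 (R : nzRingType) (V : lmodType R) (L : 'M[R]_2) (v w : V) :
  lin_act L [tuple v; w] =
  [tuple L ord0 ord0 *: v + L ord0 ord_max *: w; L ord_max ord0 *: v + L ord_max ord_max *: w].
Proof.
apply: eq_from_tnth => i; rewrite tnth_mktuple big_ord_recr big_ord1 /=.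
have -> : widen_ord (leqnSn 1) ord0 = ord0 by apply: val_inj.
case: i => -[|[|//]] lti; rewrite !(tnth_nth 0) /=.
  by rewrite (_ : Ordinal lti = ord0) //; apply: val_inj.
by rewrite (_ : Ordinal lti = ord_max) //; apply: val_inj.
Qed.

(** An invertible substitution over the base field turns a linear form
    [u - r v] with [r] outside the base field into a multiple of such a form. *)
Lemma linear_form_change_of_generators (K E : fieldType) (b : {rmorphism K -> E})
    (L : 'M[K]_2) (r : E) :
  L \in unitmx -> outside b r ->
  exists al sg : E, [/\ al != 0, outside b sg & forall (W : lmodType E) (u v : W),
    (b (L ord0 ord0) *: u + b (L ord0 ord_max) *: v) -
      r *: (b (L ord_max ord0) *: u + b (L ord_max ord_max) *: v) =
    al *: (u - sg *: v)].
Proof.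
rewrite unitmxE unitfE det_mx2 => det0 rb.
pose al := b (L ord0 ord0) - r * b (L ord_max ord0).
have al0 : al != 0.
  apply: contraNneq det0 => /(outside_indep rb)[-> ->].
  by rewrite mul0r mulr0 subr0.
exists al, (- (al^-1 * (b (L ord0 ord_max) - r * b (L ord_max ord_max)))).
split=> // [x xE|W u v].
  have [] := @outside_indep _ _ b r (L ord0 ord_max + x * L ord0 ord0)
    (L ord_max ord_max + x * L ord_max ord0) rb.
    rewrite !(rmorphD, rmorphM) /= -xE; move: al0; rewrite /al => al0; field.
    exact: al0.
  move=> /eqP; rewrite addr_eq0 => /eqP e1 /eqP; rewrite addr_eq0 => /eqP e2.
  by case/eqP: det0; rewrite e1 e2; ring.
rewrite scaleNr opprK [RHS]scalerDr [X in _ = _ + X]scalerA mulVKf // /al.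
rewrite !scalerBl scalerDr !scalerA.
by rewrite opprD addrACA.
Qed.

Lemma linear_forms_change_of_generators (K E : fieldType) (b : {rmorphism K -> E})
    (L : 'M[K]_2) (c : E) (s : seq E) :
  L \in unitmx -> c != 0 -> (forall r, r \in s -> outside b r) ->
  exists c' s', [/\ c' != 0, forall r, r \in s' -> outside b r &
    forall (A : comAlgType E) (u v : A),
    c *: \prod_(r <- s) ((b (L ord0 ord0) *: u + b (L ord0 ord_max) *: v) -
      r *: (b (L ord_max ord0) *: u + b (L ord_max ord_max) *: v)) =
    c' *: \prod_(r <- s') (u - r *: v)].
Proof.
move=> LU c0; elim: s => [|r s IH] sb.
  by exists c, [::]; split=> // A u v; rewrite !big_nil.
have [|c' [s' [c'0 s'b IHs]]] := IH; first by move=> t ts; apply: sb; rewrite inE ts orbT.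
have [al [sg [al0 sgb rE]]] := linear_form_change_of_generators LU (sb r (mem_head _ _)).
exists (al * c'), (sg :: s'); split=> [|t|A u v]; first by rewrite mulf_neq0.
  by rewrite inE => /orP[/eqP->|/s'b].
by rewrite !big_cons rE -scalerAl scalerA [c * al]mulrC -scalerA scalerAr IHs -scalerAr scalerA.
Qed.

Theorem theorem2p7 (K : closedFieldType) (n l : nat)
  (hn : (2 <= n)%N) (hl : (1 <= l)%N)
  (Om : closedFieldType) (iota : {rmorphism {fraction {mpoly K[l]}} -> Om})
  (hOm : is_algebraic_closure iota)
  (M : closedFieldType) (iota1 : {rmorphism {fraction {mpoly K[1]}} -> M})
  (hM : is_algebraic_closure iota1)
  (P : {mpoly K[n]}) (Q : 'I_l -> {mpoly K[n]})
  (hP0 : P != 0) (hQ0 : forall i, Q i != 0)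
  (hPQ : forall i, ~ equal_up_to_constant P (Q i))
  (hQQ : forall i j : 'I_l, i != j -> ~ equal_up_to_constant (Q i) (Q j))
  (hprime : relatively_prime (P :: codom Q))
  (hconst : ~ (const_mpoly P /\ forall i, const_mpoly (Q i)))
  (phi1 psi1 phi2 psi2 : {mpoly K[n]}) (H1 H2 : {mpoly Om[2]}) (d1 d2 : nat)
  (hdec1 : homogeneous_decomposition iota (linear_family P Q) phi1 psi1 H1 d1)
  (hdec2 : homogeneous_decomposition iota (linear_family P Q) phi2 psi2 H2 d2)
  (hmax1 : maximal_pencil iota1 phi1 psi1)
  (hmax2 : maximal_pencil iota1 phi2 psi2) :
  exists L : 'M[K]_2,
    [/\ L \in unitmx,
        [tuple phi1; psi1] = lin_act L [tuple phi2; psi2] &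
        reduced_decomposition iota phi1 psi1 H1 -> reduced_decomposition iota phi2 psi2 H2 ->
        exists c : K,
          of_base iota c *: H2 =
            H1 \mPo lin_act (map_mx (of_base iota) L) [tuple 'X_ord0; 'X_ord_max]].
Proof.
set F := map_mpoly (of_params iota) (linear_family P Q).
pose b : {rmorphism K -> Om} := of_base iota.
have FnC : ~ const_mpoly F by apply: linear_family_nonconst.
have F0 : F != 0 by apply/eqP => F0; apply: FnC; rewrite F0 /const_mpoly msize0.
have prime1 r : outside b r -> prime_elt (pencil b phi1 psi1 r).
  by move=> rb; apply/irreducible_mpoly_prime/(maximal_pencil_irreducible hmax1 rb).
have prime2 r : outside b r -> prime_elt (pencil b phi2 psi2 r).
  by move=> rb; apply/irreducible_mpoly_prime/(maximal_pencil_irreducible hmax2 rb).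
have [c1 [k1 [s1 [c10 H1E FE1 kC1 sC1]]]] := decomposition_factor hdec1 hprime F0.
have [c2 [k2 [s2 [c20 H2E FE2 kC2 sC2]]]] := decomposition_factor hdec2 hprime F0.
(* A factor of the first decomposition that is not defined over [K] is
   proportional to a factor of the second one. *)
have [r rs1 rb] := decomposition_outside FnC FE1 kC1 sC1.
have [prim1 _ _ _] := hdec1; have [prim2 _ _ _] := hdec2.
have free1 x y : x *: map_mpoly b phi1 + y *: map_mpoly b psi1 = 0 -> x = 0 /\ y = 0.
  exact: pencil_free prim1 (maximal_pencil_irreducible hmax1 rb).
have free2 x y : x *: map_mpoly b phi2 + y *: map_mpoly b psi2 = 0 -> x = 0 /\ y = 0.
  exact: pencil_free prim2 (maximal_pencil_irreducible hmax2 rb).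
have dvdF : divides (pencil b phi1 psi1 r) F.
  exists (c1 *: (map_mpoly b psi1 ^+ k1 * \prod_(t <- rem r s1) pencil b phi1 psi1 t)).
  rewrite /F FE1 (perm_big _ (perm_to_rem rs1)) big_cons -scalerAl -mulrA.
  by rewrite [X in _ = _ *: (_ * X)]mulrC.
have [t [ts2 tb rt]] := decomposition_prime_divisor F0 c20 FE2 kC2 sC2 (prime1 r rb) dvdF.
have [u uU tE] := prime_dvd_prime (prime1 r rb) (prime2 t tb) rt.
have [c rE] : exists c, pencil b phi1 psi1 r = c *: pencil b phi2 psi2 t.
  move: uU tE; rewrite mpoly_unit_const => /andP[u0 /msize1_polyC uE].
  have c0 : u@_0 != 0 by apply: contraNneq u0 => c0; rewrite uE c0 mpolyC0.
  rewrite uE mul_mpolyC => tE; exists (u@_0)^-1.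
  by rewrite tE scalerA mulVf // scale1r.
have [L [phiE psiE]] := proportional_members_span rb rE.
have LU : L \in unitmx.
  apply: change_of_generators_unit phiE psiE => x y E0.
  have [] := free1 (b x) (b y); last by move=> /eqP + /eqP; rewrite !fmorph_eq0 => /eqP + /eqP.
  by rewrite -!map_mpolyZ -raddfD /= E0 raddf0.
exists L; split=> // [|red1 red2]; first by rewrite lin_act2 -phiE -psiE.
(* The two products of linear forms take the same value at the generators of the
   second pencil; unique factorization there identifies their constants and
   parameters. *)
exists 1; rewrite rmorph1 scale1r.
rewrite H1E in red1; rewrite H2E in red2.
have [k10 s1b] := reduced_decomposition_outside red1 kC1 sC1.
have [k20 s2b] := reduced_decomposition_outside red2 kC2 sC2.
have [c' [s' [c'0 s'b LE]]] := linear_forms_change_of_generators LU c10 s1b.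
have phiE' : map_mpoly b phi1 =
    b (L ord0 ord0) *: map_mpoly b phi2 + b (L ord0 ord_max) *: map_mpoly b psi2.
  by rewrite {1}phiE raddfD /= !map_mpolyZ.
have psiE' : map_mpoly b psi1 =
    b (L ord_max ord0) *: map_mpoly b phi2 + b (L ord_max ord_max) *: map_mpoly b psi2.
  by rewrite {1}psiE raddfD /= !map_mpolyZ.
have FE1' : F = c' *: \prod_(r <- s') pencil b phi2 psi2 r.
  by rewrite /pencil -LE /F FE1 k10 expr0 mul1r /pencil phiE' psiE'.
have FE2' : F = c2 *: \prod_(r <- s2) pencil b phi2 psi2 r by rewrite /F FE2 k20 expr0 mul1r.
have [cE sE] := pencil_unique_factorization free2
  (fun t' ht => prime2 t' (s'b t' ht)) (fun t' ht => prime2 t' (s2b t' ht))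
  c'0 c20 (etrans (esym FE1') FE2').
rewrite H1E H2E lin_act2 comp_mpoly_factored k10 k20 !expr0 !mul1r !mxE LE cE.
by rewrite (perm_big _ sE).
Qed.
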